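(* Let $M$ be a point of the side (arc) $V_1V_2$ of the Reuleaux triangle with vertices $V_1,V_2,V_3$, $M\neq V_1,V_2$, and let $\mathcal{C}^*$ be the associated endpoint conic, i.e. the conic through $P_0,A_1,A_2,B_1,B_2$. Let $\mathbf{c}$ be the exinscribed circle of $\triangle V_1'O'V_2'$ that is externally tangent to the side $V_1'V_2'$. Then $\mathcal{C}^*$ is the polar-dual of the circle $\mathbf{c}$ with respect to the inversion circle $\mathcal{I}$ centered at $M$. Moreover, $\mathcal{C}^*$ is an ellipse if $M$ lies inside $\mathbf{c}$, a hyperbola if $M$ lies outside $\mathbf{c}$, and a parabola if $M$ lies on $\mathbf{c}$.
   Context: Let $V_1V_2V_3$ be an equilateral triangle in the plane with side length $r$. The Reuleaux triangle $\mathcal{R}$ is the closed convex curve formed by three circular arcs (its sides) of radius $r$: the arc $V_iV_j$ has center $V_k$ and is the minor ($60^\circ$) arc from $V_i$ to $V_j$, $\{i,j,k\}=\{1,2,3\}$. Negative pedal curve: for a regular curve parametrized by $\gamma$ and a pedal point $M$, its negative pedal curve is the envelope of the lines $\ell_P$ through points $P=\gamma(t)\ne M$ of the curve and perpendicular to $PM$. The image of $P=\gamma(t)$ is the point $X$ of $\ell_P$ where $\ell_P$ touches the envelope, i.e. the point $X$ with $(X-\gamma(t))\cdot(\gamma(t)-M)=0$ and $\frac{\partial}{\partial t}\big[(X-\gamma(t))\cdot(\gamma(t)-M)\big]=0$. Here $M$ lies on the arc $V_1V_2$ (centered at $V_3$), whose negative pedal curve is a single point $P_0$ (the antipode of $M$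 on the circle centered at $V_3$). The negative pedal curves of the arcs $V_1V_3$ and $V_2V_3$ are elliptic arcs $A_1A_2$ and $B_1B_2$ respectively: $A_1$ is the image of $V_1$ and $A_2$ the image of $V_3$, both regarded as points of the arc $V_1V_3$; $B_1$ is the image of $V_2$ and $B_2$ the image of $V_3$, both regarded as points of the arc $V_2V_3$. $\mathcal{I}$ is a circle centered at $M$ (the inversion circle); all inversions, poles and polars are with respect to $\mathcal{I}$. $V_i'$ denotes the inverse of $V_i$. The inverses of the arcs $V_1V_3$ and $V_2V_3$ are circular arcs denoted $V_1'V_3'$ and $V_2'V_3'$. $O'$ is the intersection of the tangent at $V_1'$ to the arc $V_1'V_3'$ with the tangent at $V_2'$ to the arc $V_2'V_3'$; $\triangle V_1'O'V_2'$ is equilateral. The polar-dual of a curve $\Gamma$ with respect to $\mathcal{I}$ is the locus of the poles of the tangents of $\Gamma$; equivalently, the envelope of the polars of the points of $\Gamma$. *)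

(* Defs.v *)
From Stdlib Require Import Reals Lra.
From Coquelicot Require Import Coquelicot.
Open Scope R_scope.

(* Coquelicot's [norm] on this product is the Euclidean norm
   [sqrt (|x|^2 + |y|^2)]. *)
Notation plane := (R * R)%type.

Definition dot (u v : plane) : R := fst u * fst v + snd u * snd v.

Definition pdist (P Q : plane) : R := norm (minus P Q).

Definition line (A B : plane) (X : plane) : Prop :=
  exists s : R, X = plus A (scal s (minus B A)).

Definition equilateral (r : R) (A B C : plane) : Prop :=
  pdist A B = r /\ pdist B C = r /\ pdist C A = r.

(* The minor arc with centre [C] from [A] (at [t = 0]) to [B] (at [t = PI / 3]),
   when [A] and [B] lie on a circle with centre [C] and the angle [ACB] is 60
   degrees; [t] is then the angle from [CA].  This form does not depend on
   whether [A], [B], [C] are in clockwise or counterclockwise order. *)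
Definition arc60 (C A B : plane) (t : R) : plane :=
  plus C (plus (scal (sin (PI / 3 - t) / sin (PI / 3)) (minus A C))
               (scal (sin t / sin (PI / 3)) (minus B C))).

Definition on_arc60 (C A B X : plane) : Prop :=
  exists t : R, 0 <= t <= PI / 3 /\ X = arc60 C A B t.

Definition circle_curve (c : plane) (rho : R) (t : R) : plane :=
  plus c (scal rho ((cos t, sin t) : plane)).

Definition tangent_line (gamma : R -> plane) (t : R) (X : plane) : Prop :=
  exists (v : plane) (s : R),
    is_derive gamma t v /\ v <> zero /\ X = plus (gamma t) (scal s v).

Definition neg_pedal_image (gamma : R -> plane) (M : plane) (t : R) (X : plane)
  : Prop :=
  gamma t <> M /\
  dot (minus X (gamma t)) (minus (gamma t) M) = 0 /\
  is_derive (fun s => dot (minus X (gamma s)) (minus (gamma s) M)) t 0.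

Definition neg_pedal_curve (gamma : R -> plane) (a b : R) (M X : plane) : Prop :=
  exists t : R, a <= t <= b /\ neg_pedal_image gamma M t X.

(* Inversion, polars and poles are with respect to the circle with centre [M]
   and radius [k]. *)
Definition inversion (M : plane) (k : R) (P : plane) : plane :=
  plus M (scal (k ^ 2 / pdist P M ^ 2) (minus P M)).

Definition polar (M : plane) (k : R) (X : plane) (Y : plane) : Prop :=
  dot (minus X M) (minus Y M) = k ^ 2.

(* For [k > 0] the polar of [M] is empty, so a line through [M] has no pole. *)
Definition is_pole (M : plane) (k : R) (L : plane -> Prop) (X : plane) : Prop :=
  forall Y : plane, L Y <-> polar M k X Y.

Definition polar_dual (M : plane) (k : R) (gamma : R -> plane) (X : plane)
  : Prop :=
  exists t : R, is_pole M k (tangent_line gamma t) X.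

Definition tangent_to_circle_at (L : plane -> Prop) (c : plane) (rho : R)
  (T : plane) : Prop :=
  exists t : R, circle_curve c rho t = T /\
    forall Y : plane, tangent_line (circle_curve c rho) t Y <-> L Y.

(* The excircle of the triangle [A O B] opposite [O]: tangent to the side [AB]
   and to the extensions of [OA] beyond [A] and of [OB] beyond [B]. *)
Definition excircle (A O B : plane) (c : plane) (rho : R) : Prop :=
  0 < rho /\
  (exists s : R, 0 < s < 1 /\
     tangent_to_circle_at (line A B) c rho (plus A (scal s (minus B A)))) /\
  (exists s : R, 1 < s /\
     tangent_to_circle_at (line O A) c rho (plus O (scal s (minus A O)))) /\
  (exists s : R, 1 < s /\
     tangent_to_circle_at (line O B) c rho (plus O (scal s (minus B O)))).

Definition is_conic (S : plane -> Prop) : Prop :=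
  exists a b c d e f : R, ~ (a = 0 /\ b = 0 /\ c = 0) /\
    forall X : plane, S X <->
      a * fst X ^ 2 + b * (fst X * snd X) + c * snd X ^ 2
      + d * fst X + e * snd X + f = 0.

(* Circles are included ([F1 = F2]). *)
Definition is_ellipse (S : plane -> Prop) : Prop :=
  exists (F1 F2 : plane) (a : R), pdist F1 F2 < 2 * a /\
    forall X : plane, S X <-> pdist X F1 + pdist X F2 = 2 * a.

Definition is_hyperbola (S : plane -> Prop) : Prop :=
  exists (F1 F2 : plane) (a : R), 0 < a /\ 2 * a < pdist F1 F2 /\
    forall X : plane, S X <-> Rabs (pdist X F1 - pdist X F2) = 2 * a.

(* The directrix is [{Y | dot n Y = p}] with [n] a unit normal. *)
Definition is_parabola (S : plane -> Prop) : Prop :=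
  exists (F n : plane) (p : R), norm n = 1 /\ dot n F <> p /\
    forall X : plane, S X <-> pdist X F = Rabs (dot n X - p).

Lemma sin_PI3_neq0 : sin (PI / 3) <> 0.
Proof.
  apply Rgt_not_eq, sin_gt_0; generalize PI_RGT_0; lra.
Qed.

Lemma arc60_start (C A B : plane) : arc60 C A B 0 = A.
Proof.
  generalize sin_PI3_neq0; intro H.
  unfold arc60; rewrite Rminus_0_r, sin_0.
  apply injective_projections; cbn; unfold plus, opp, scal, mult; cbn;
    unfold mult; cbn; field; exact H.
Qed.

Lemma arc60_end (C A B : plane) : arc60 C A B (PI / 3) = B.
Proof.
  generalize sin_PI3_neq0; intro H.
  unfold arc60; rewrite Rminus_diag, sin_0.
  apply injective_projections; cbn; unfold plus, opp, scal, mult; cbn;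
    unfold mult; cbn; field; exact H.
Qed.

(* Main.v *)
Require Import Defs.
From Stdlib Require Import Reals Lra Psatz List.
From Coquelicot Require Import Coquelicot.
Import ListNotations.
Open Scope R_scope.

(** Why the theorem holds.  Write w = X - M and d = c - M.

    The tangent of the circle (c, rho) with unit normal u is the line
    u . (Y - M) = rho + d . u, so its pole X satisfies
    (rho + d . u) w = k^2 u ([is_pole_tangent_circle]).  Eliminating u leaves
    rho |w| = |k^2 - d . w| ([polar_dual_circle]): the polar-dual of the circle is
    the conic with focus M, directrix the polar of c, and eccentricity |d| / rho.
    Its type is therefore decided by the position of M with respect to the circle
    ([focal_ellipse], [focal_hyperbola], [focal_parabola]).

    A conic is determined by five distinct points of such a curve
    ([conic_through_five_points]): under the projective map that sends X to the
    normal u of its polar, they become five points of the unit circle, and a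
    quadratic polynomial that vanishes there is a multiple of x^2 + y^2 - 1.  So
    it is enough that P0, A1, A2, B1, B2 are distinct and lie on the polar-dual
    of the excircle, in other words that their polars touch the excircle.

    A negative pedal curve is the polar-dual of the inverse curve
    ([tangent_inversion_polar]).  Hence the polars of A1 and B1 are the sides
    O'V1' and O'V2' of the triangle, and that of P0 is the side V1'V2'; the
    polars of A2 and B2 are the tangents at V3' to the two inverted arcs.  That
    the last two also touch the excircle is the special feature of the
    configuration.  As the triangle is equilateral, its excircle has centre
    V1' + V2' - O' and radius equal to the height ([equilateral_excircle]).  The
    position of M on its arc is parametrised rationally ([reuleaux_frame]), in a
    basis in which no square root occurs; then the five incidences are identities
    between rational functions of one parameter. *)

(** * Plane vectors and their derivatives *)

Ltac unfold_plane :=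
  unfold dot, minus, plus, opp, scal, mult, zero in *; cbn in *;
  unfold mult in *; cbn in *.

(** Adds a multiple of a known equation to a goal, so that [ring] or [field] can
    close goals that hold modulo polynomial relations. *)
Lemma eq_modulo (a b k x y : R) : a = b -> x - k * a = y - k * b -> x = y.
Proof. intros ->; lra. Qed.

Lemma plane_eq (P Q : plane) : fst P = fst Q -> snd P = snd Q -> P = Q.
Proof. exact (injective_projections P Q). Qed.

Lemma pdist_sqrt (P Q : plane) :
  pdist P Q = sqrt (dot (minus P Q) (minus P Q)).
Proof.
  unfold pdist, norm; cbn; unfold prod_norm, norm; cbn.
  unfold abs; cbn.
  rewrite !Rmult_1_r, <- !Rabs_mult, !Rabs_pos_eq by apply Rle_0_sqr.
  reflexivity.
Qed.

Lemma dot_self_ge0 (u : plane) : 0 <= dot u u.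
Proof. unfold dot; nra. Qed.

Lemma pdist_ge0 (P Q : plane) : 0 <= pdist P Q.
Proof. rewrite pdist_sqrt; apply sqrt_pos. Qed.

Lemma pdist_sq (P Q : plane) :
  pdist P Q ^ 2 = dot (minus P Q) (minus P Q).
Proof. rewrite pdist_sqrt; apply pow2_sqrt, dot_self_ge0. Qed.

Lemma dot_sq_le (u v : plane) : dot u v ^ 2 <= dot u u * dot v v.
Proof.
  unfold dot.
  generalize (pow2_ge_0 (fst u * snd v - snd u * fst v)); nra.
Qed.

Lemma is_derive_fst (g : R -> plane) (t : R) (v : plane) :
  is_derive g t v -> is_derive (fun s => fst (g s)) t (fst v).
Proof.
  intro H.
  apply (filterdiff_comp g (fun u : plane => fst u) (fun y => scal y v)
           (fun u : plane => fst u)) in H.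
  2: apply filterdiff_linear, is_linear_fst.
  exact H.
Qed.

Lemma is_derive_snd (g : R -> plane) (t : R) (v : plane) :
  is_derive g t v -> is_derive (fun s => snd (g s)) t (snd v).
Proof.
  intro H.
  apply (filterdiff_comp g (fun u : plane => snd u) (fun y => scal y v)
           (fun u : plane => snd u)) in H.
  2: apply filterdiff_linear, is_linear_snd.
  exact H.
Qed.

Lemma is_derive_coords (x y : R -> R) (t dx dy : R) :
  is_derive x t dx -> is_derive y t dy ->
  is_derive (fun s => (x s, y s) : plane) t (dx, dy).
Proof.
  intros Hx Hy.
  apply (is_derive_ext
    (fun s => plus (scal (x s) ((1, 0) : plane)) (scal (y s) ((0, 1) : plane)))).
  { intro s; apply plane_eq; unfold_plane; ring. }
  replace ((dx, dy) : plane)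
    with (plus (scal dx ((1, 0) : plane)) (scal dy ((0, 1) : plane)))
    by (apply plane_eq; unfold_plane; ring).
  refine (is_derive_plus _ _ _ _ _ _ _).
  - exact (is_derive_scal_l x t dx ((1, 0) : plane) Hx).
  - exact (is_derive_scal_l y t dy ((0, 1) : plane) Hy).
Qed.

Lemma is_derive_plane_unique (g : R -> plane) (t : R) (v w : plane) :
  is_derive g t v -> is_derive g t w -> v = w.
Proof.
  intros Hv Hw; apply plane_eq.
  - rewrite <- (is_derive_unique _ _ _ (is_derive_fst _ _ _ Hv)).
    exact (is_derive_unique _ _ _ (is_derive_fst _ _ _ Hw)).
  - rewrite <- (is_derive_unique _ _ _ (is_derive_snd _ _ _ Hv)).
    exact (is_derive_unique _ _ _ (is_derive_snd _ _ _ Hw)).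
Qed.

(** * The polar-dual of a circle *)

Definition unit_vec (t : R) : plane := (cos t, sin t).

Lemma unit_vec_dot t : dot (unit_vec t) (unit_vec t) = 1.
Proof. unfold dot, unit_vec; cbn. generalize (sin2_cos2 t); unfold Rsqr; lra. Qed.

Lemma tangent_line_circle (c : plane) (rho t : R) (Y : plane) :
  0 < rho ->
  tangent_line (circle_curve c rho) t Y <->
  dot (minus Y c) (unit_vec t) = rho.
Proof.
  intro Hrho.
  assert (Hd : is_derive (circle_curve c rho) t
                 (scal rho ((- sin t, cos t) : plane))).
  { apply (is_derive_ext
      (fun s => (fst c + rho * cos s, snd c + rho * sin s) : plane)).
    { intro s; apply plane_eq; unfold_plane; reflexivity. }
    replace (scal rho ((- sin t, cos t) : plane))
      with ((rho * - sin t, rho * cos t) : plane)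
      by (apply plane_eq; unfold_plane; reflexivity).
    apply is_derive_coords; auto_derive; trivial; ring. }
  generalize (unit_vec_dot t); unfold unit_vec; intro Hu.
  split.
  - intros (v & s & Hv & _ & ->).
    rewrite <- (is_derive_plane_unique _ _ _ _ Hd Hv).
    unfold circle_curve; unfold_plane.
    apply (eq_modulo _ _ rho _ _ Hu); ring.
  - intro H.
    exists (scal rho ((- sin t, cos t) : plane)),
      (dot (minus Y c) ((- sin t, cos t) : plane) / rho).
    split; [exact Hd | split].
    + intro H0; generalize (f_equal fst H0) (f_equal snd H0); unfold_plane.
      intros H1 H2.
      assert (rho * rho = 0); [|nra].
      apply (eq_modulo _ _ (- (rho * sin t)) _ _ H1).
      apply (eq_modulo _ _ (rho * cos t) _ _ H2).
      apply (eq_modulo _ _ (- (rho * rho)) _ _ Hu); ring.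
    + unfold circle_curve; apply plane_eq; unfold_plane.
      all: field_simplify_eq; [| lra].
      * apply (eq_modulo _ _ (cos t) _ _ H).
        apply (eq_modulo _ _ (fst c - fst Y) _ _ Hu); ring.
      * apply (eq_modulo _ _ (sin t) _ _ H).
        apply (eq_modulo _ _ (snd c - snd Y) _ _ Hu); ring.
Qed.

Lemma unit_vec_surj x y : x ^ 2 + y ^ 2 = 1 -> exists t, unit_vec t = (x, y).
Proof.
  intro H.
  assert (Hc : cos (acos x) = x) by (apply cos_acos; nra).
  assert (Hs : sin (acos x) ^ 2 = y ^ 2)
    by (generalize (sin2_cos2 (acos x)); rewrite Hc; unfold Rsqr; lra).
  unfold unit_vec; destruct (Req_dec (sin (acos x)) y) as [E|E].
  - exists (acos x); rewrite Hc, E; reflexivity.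
  - exists (- acos x); rewrite cos_neg, sin_neg, Hc; f_equal.
    assert (E2 : (sin (acos x) - y) * (sin (acos x) + y) = 0) by lra.
    apply Rmult_integral in E2; destruct E2; lra.
Qed.

(** Both sides say that the lines u . (Y - M) = rho + d . u and w . (Y - M) = k^2
    have proportional equations.  If the tangent passes through M the left factor
    vanishes while the right side does not, which reflects that such a line has
    no pole. *)
Lemma is_pole_tangent_circle (M c X : plane) (k rho t : R) :
  0 < k -> 0 < rho ->
  is_pole M k (tangent_line (circle_curve c rho) t) X <->
  scal (rho + dot (minus c M) (unit_vec t)) (minus X M) =
  scal (k ^ 2) (unit_vec t).
Proof.
  intros Hk Hrho.
  assert (Hk2 : 0 < k * k) by nra.
  assert (Hu := unit_vec_dot t); unfold unit_vec in *.
  split.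
  - intro H.
    set (h := rho + dot (minus c M) ((cos t, sin t) : plane)).
    (* The points of the tangent at signed distance s from the foot of the
       perpendicular from M. *)
    assert (HY : forall s : R,
      (h * cos t - s * sin t) * (fst X - fst M)
      + (h * sin t + s * cos t) * (snd X - snd M) = k ^ 2).
    { intro s.
      destruct (H (plus M ((h * cos t - s * sin t, h * sin t + s * cos t)
                             : plane))) as [H1 _].
      rewrite tangent_line_circle in H1 by exact Hrho.
      unfold polar in H1; unfold h in *; unfold_plane.
      rewrite <- H1.
      - ring.
      - apply (eq_modulo _ _ ((rho + ((fst c + - fst M) * cos t
          + (snd c + - snd M) * sin t))) _ _ Hu); ring. }
    generalize (HY 0) (HY 1); fold h; clearbody h; clear HY H; intros H0 H1.
    assert (H2 : cos t * (snd X - snd M) = sin t * (fst X - fst M)) by lra.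
    apply plane_eq; unfold_plane.
    + apply (eq_modulo _ _ (cos t) _ _ H0).
      apply (eq_modulo _ _ (h * sin t) _ _ (eq_sym H2)).
      apply (eq_modulo _ _ (h * (fst X - fst M)) _ _ (eq_sym Hu)); ring.
    + apply (eq_modulo _ _ (sin t) _ _ H0).
      apply (eq_modulo _ _ (h * cos t) _ _ H2).
      apply (eq_modulo _ _ (h * (snd X - snd M)) _ _ (eq_sym Hu)); ring.
  - intros H Y.
    rewrite tangent_line_circle by exact Hrho.
    generalize (f_equal fst H) (f_equal snd H); clear H.
    unfold polar.
    set (h := rho + dot (minus c M) ((cos t, sin t) : plane)).
    assert (Hh : dot (minus Y c) ((cos t, sin t) : plane) = rho <->
                 (fst Y - fst M) * cos t + (snd Y - snd M) * sin t = h).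
    { unfold h; unfold_plane; split; intro; lra. }
    rewrite Hh; clearbody h; clear Hh.
    unfold_plane; intros H1 H2.
    assert (Hh : h <> 0).
    { intros ->.
      assert (cos t = 0) by nra. assert (sin t = 0) by nra. nra. }
    assert (H3 : h * ((fst X - fst M) * (fst Y - fst M)
                      + (snd X - snd M) * (snd Y - snd M)) =
      k ^ 2 * ((fst Y - fst M) * cos t + (snd Y - snd M) * sin t)).
    { apply (eq_modulo _ _ (fst Y - fst M) _ _ H1).
      apply (eq_modulo _ _ (snd Y - snd M) _ _ H2); ring. }
    split; intro H4.
    + rewrite H4 in H3. apply (Rmult_eq_reg_l h); [lra | exact Hh].
    + apply (Rmult_eq_reg_l (k * k)); [|lra].
      transitivity (h * ((fst X - fst M) * (fst Y - fst M)
                      + (snd X - snd M) * (snd Y - snd M))).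
      * rewrite H3; ring.
      * replace (k * k) with (k * (k * 1)) by ring. rewrite <- H4; ring.
Qed.

(** The conic with focus [M] and eccentricity |d| / rho whose directrix is the
    polar of [M + d]; for [d = 0], a circle. *)
Definition focal_eq (M d : plane) (k rho : R) (X : plane) : Prop :=
  rho * pdist X M = Rabs (k ^ 2 - dot d (minus X M)).

Lemma dot_scal_l a u v : dot (scal a u) v = a * dot u v.
Proof. unfold_plane; ring. Qed.

Lemma polar_dual_circle (M c X : plane) (k rho : R) :
  0 < k -> 0 < rho ->
  polar_dual M k (circle_curve c rho) X <-> focal_eq M (minus c M) k rho X.
Proof.
  intros Hk Hrho.
  assert (Hk2 : 0 < k ^ 2) by nra.
  unfold polar_dual, focal_eq.
  assert (Hw := pdist_sq X M).
  assert (Hw0 := pdist_ge0 X M).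
  set (n := pdist X M) in *; clearbody n.
  set (d := minus c M : plane); set (w := minus X M : plane) in *.
  split.
  - intros [t Ht]; rewrite is_pole_tangent_circle in Ht by assumption.
    fold d w in Ht.
    assert (Hu := unit_vec_dot t).
    set (u := unit_vec t) in *; clearbody u d w.
    set (h := rho + dot d u) in *.
    assert (H0 : forall v, h * dot w v = k ^ 2 * dot u v).
    { intro v; rewrite <- !dot_scal_l.
      exact (f_equal (fun p : plane => dot p v) Ht). }
    assert (H1 := H0 w); assert (H2 := H0 u); assert (H3 := H0 d).
    rewrite Hu, Rmult_1_r in H2.
    assert (Hh : h <> 0) by (intro E; rewrite E in H2; lra).
    replace (k ^ 2 - dot d w) with (rho * (k ^ 2 / h)).
    + rewrite Rabs_mult, (Rabs_pos_eq rho) by lra; f_equal.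
      rewrite <- (Rabs_pos_eq n Hw0).
      apply Rsqr_eq_abs_0; unfold Rsqr.
      transitivity (n ^ 2); [ring|]; rewrite Hw.
      replace (dot w w) with (k ^ 2 / h * dot u w)
        by (apply (Rmult_eq_reg_l h); [rewrite H1; field; lra | exact Hh]).
      replace (dot u w) with (dot w u) by (unfold dot; ring).
      rewrite <- H2; field; lra.
    + apply (Rmult_eq_reg_l h); [|exact Hh].
      replace (dot d w) with (dot w d) by (unfold dot; ring).
      rewrite Rmult_minus_distr_l, H3.
      replace (dot u d) with (h - rho) by (unfold h, dot; ring).
      field; lra.
  - intro H.
    assert (Hn : 0 < n).
    { destruct Hw0 as [|E]; [assumption|exfalso].
      rewrite <- E, Rmult_0_r in H; rewrite <- E in Hw.
      assert (fst w = 0 /\ snd w = 0) as [E1 E2]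
        by (apply Rplus_sqr_eq_0; unfold dot in Hw; unfold Rsqr; lra).
      unfold dot in H; rewrite E1, E2, !Rmult_0_r, Rplus_0_r, Rminus_0_r in H.
      rewrite Rabs_pos_eq in H; lra. }
    (* The tangent point lies in the direction of w, or in the opposite one,
       according to the side of the polar of c on which X lies. *)
    assert (Hs : exists s : R, s * s = 1 /\ s * (rho * n) = k ^ 2 - dot d w).
    { destruct (Rcase_abs (k ^ 2 - dot d w)) as [L|L].
      - exists (-1); rewrite (Rabs_left _ L) in H; lra.
      - exists 1; rewrite (Rabs_right _ L) in H; lra. }
    destruct Hs as (s & Hs1 & Hs2).
    assert (Hu : (s * fst w / n) ^ 2 + (s * snd w / n) ^ 2 = 1).
    { replace ((s * fst w / n) ^ 2 + (s * snd w / n) ^ 2)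
        with (s * s * dot w w / n ^ 2) by (unfold dot; field; lra).
      rewrite <- Hw, Hs1; field; lra. }
    destruct (unit_vec_surj _ _ Hu) as [t Ht].
    exists t; apply is_pole_tangent_circle; [assumption..|].
    fold d w; rewrite Ht.
    assert (Hh : rho + dot d ((s * fst w / n, s * snd w / n) : plane) =
                 s * k ^ 2 / n).
    { replace (k ^ 2) with (s * (rho * n) + dot d w) by lra.
      transitivity (s * s * rho + s * dot d w / n).
      - rewrite Hs1; unfold dot; cbn; field; lra.
      - field; lra. }
    rewrite Hh; apply plane_eq; unfold_plane; field; lra.
Qed.

(** The second focus is the reflection of [M] in the centre M - (k^2 / D) d, where
    D = rho^2 - |d|^2.  With n and m the distances to the foci, m^2 - (2 a - n)^2
    is a multiple of rho n - (k^2 - d . w), which links the two descriptions; the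
    signs are settled by the inequality of Cauchy and Schwarz. *)
Lemma focal_ellipse (M d : plane) (k rho : R) (S : plane -> Prop) :
  0 < k -> 0 < rho -> dot d d < rho ^ 2 ->
  (forall X, S X <-> focal_eq M d k rho X) -> is_ellipse S.
Proof.
  intros Hk Hrho Hd HS.
  assert (Hk2 : 0 < k ^ 2) by nra.
  set (D := rho ^ 2 - dot d d).
  assert (HD : 0 < D) by (unfold D; lra).
  set (F := plus M (scal (- 2 * k ^ 2 / D) d)).
  set (a := k ^ 2 * rho / D).
  assert (Ha : a * D = k ^ 2 * rho) by (unfold a; field; lra).
  assert (Ha0 : 0 < a) by (unfold a; apply Rdiv_lt_0_compat; nra).
  exists M, F, a; split.
  - assert (H := pdist_sq M F); assert (H0 := pdist_ge0 M F).
    replace (dot (minus M F) (minus M F)) with (4 * k ^ 2 * k ^ 2 * dot d d / D ^ 2)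
      in H by (unfold F; unfold_plane; field; lra).
    assert (H1 : (2 * a) ^ 2 = 4 * k ^ 2 * k ^ 2 * rho ^ 2 / D ^ 2)
      by (unfold a; field; lra).
    assert (H2 : 4 * k ^ 2 * k ^ 2 * dot d d / D ^ 2 < 4 * k ^ 2 * k ^ 2 * rho ^ 2 / D ^ 2).
    { apply Rmult_lt_compat_r; [apply Rinv_0_lt_compat; nra|].
      apply Rmult_lt_compat_l; nra. }
    nra.
  - intro X; rewrite HS; unfold focal_eq.
    assert (Hn := pdist_sq X M); assert (Hn0 := pdist_ge0 X M).
    assert (Hm := pdist_sq X F); assert (Hm0 := pdist_ge0 X F).
    replace (dot (minus X F) (minus X F)) with
      (dot (minus X M) (minus X M) + 4 * k ^ 2 / D * dot d (minus X M)
       + 4 * k ^ 2 * k ^ 2 * dot d d / D ^ 2) in Hm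
      by (unfold F; unfold_plane; field; lra).
    rewrite <- Hn in Hm.
    assert (Hcs := dot_sq_le d (minus X M)); rewrite <- Hn in Hcs.
    set (n := pdist X M) in *; set (m := pdist X F) in *.
    set (x := dot d (minus X M)) in *; clearbody n m x.
    assert (Hm' : m ^ 2 = (2 * a - n) ^ 2
                  + 4 * k ^ 2 / D * (x + rho * n - k ^ 2)).
    { rewrite Hm; unfold a.
      replace (dot d d) with (rho ^ 2 - D) by (unfold D; ring).
      field; lra. }
    assert (HkD : 0 < 4 * k ^ 2 / D) by (apply Rdiv_lt_0_compat; lra).
    split; intro H.
    + assert (H1 : rho * n = k ^ 2 - x).
      { destruct (Rcase_abs (k ^ 2 - x)) as [L|L].
        - rewrite (Rabs_left _ L) in H. exfalso.
          assert (x ^ 2 <= rho ^ 2 * n ^ 2) by nra.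
          nra.
        - rewrite (Rabs_right _ L) in H; exact H. }
      replace (x + rho * n - k ^ 2) with 0 in Hm' by lra.
      assert (n <= 2 * a).
      { apply (Rmult_le_reg_r D); [exact HD|].
        replace x with (k ^ 2 - rho * n) in Hcs by lra.
        replace (dot d d) with (rho ^ 2 - D) in Hcs by (unfold D; ring).
        apply Rnot_lt_le; intro L.
        assert (0 <= n * (n * D - 2 * (a * D)))
          by (apply Rmult_le_pos; lra).
        rewrite Ha in *; nra. }
      nra.
    + assert (H1 : x + rho * n - k ^ 2 = 0).
      { apply (Rmult_eq_reg_l (4 * k ^ 2 / D)); [|lra].
        replace m with (2 * a - n) in Hm' by lra; lra. }
      rewrite Rabs_pos_eq; nra.
Qed.

(** As for the ellipse, with D = |d|^2 - rho^2.  The two signs of k^2 - d . w are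
    the two branches; the triangle inequality excludes m = 2 a - n on the branch
    where m^2 = (n - 2 a)^2. *)
Lemma focal_hyperbola (M d : plane) (k rho : R) (S : plane -> Prop) :
  0 < k -> 0 < rho -> rho ^ 2 < dot d d ->
  (forall X, S X <-> focal_eq M d k rho X) -> is_hyperbola S.
Proof.
  intros Hk Hrho Hd HS.
  assert (Hk2 : 0 < k ^ 2) by nra.
  set (D := dot d d - rho ^ 2).
  assert (HD : 0 < D) by (unfold D; lra).
  set (F := plus M (scal (2 * k ^ 2 / D) d)).
  set (a := k ^ 2 * rho / D).
  assert (Ha : a * D = k ^ 2 * rho) by (unfold a; field; lra).
  assert (Ha0 : 0 < a) by (unfold a; apply Rdiv_lt_0_compat; nra).
  assert (HF : 2 * a < pdist M F).
  { assert (H := pdist_sq M F); assert (H0 := pdist_ge0 M F).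
    replace (dot (minus M F) (minus M F)) with (4 * k ^ 2 * k ^ 2 * dot d d / D ^ 2)
      in H by (unfold F; unfold_plane; field; lra).
    assert (H1 : (2 * a) ^ 2 = 4 * k ^ 2 * k ^ 2 * rho ^ 2 / D ^ 2)
      by (unfold a; field; lra).
    assert (H2 : 4 * k ^ 2 * k ^ 2 * rho ^ 2 / D ^ 2 < 4 * k ^ 2 * k ^ 2 * dot d d / D ^ 2).
    { apply Rmult_lt_compat_r; [apply Rinv_0_lt_compat; nra|].
      apply Rmult_lt_compat_l; nra. }
    nra. }
  exists M, F, a; split; [exact Ha0 | split; [exact HF |]].
  intro X; rewrite HS; unfold focal_eq.
  assert (Htri : pdist M F <= pdist X M + pdist X F).
  { unfold pdist.
    replace (minus M F) with (plus (minus M X) (minus X F))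
      by (apply plane_eq; unfold_plane; ring).
    rewrite <- (norm_opp (minus X M)), opp_minus.
    apply (norm_triangle (minus M X : plane)). }
  assert (Hn := pdist_sq X M); assert (Hn0 := pdist_ge0 X M).
  assert (Hm := pdist_sq X F); assert (Hm0 := pdist_ge0 X F).
  replace (dot (minus X F) (minus X F)) with
    (dot (minus X M) (minus X M) - 4 * k ^ 2 / D * dot d (minus X M)
     + 4 * k ^ 2 * k ^ 2 * dot d d / D ^ 2) in Hm
    by (unfold F; unfold_plane; field; lra).
  rewrite <- Hn in Hm.
  set (n := pdist X M) in *; set (m := pdist X F) in *.
  set (x := dot d (minus X M)) in *; clearbody n m x.
  assert (Hkey : forall s, s * s = 1 ->
    m ^ 2 = (2 * a + s * n) ^ 2 + 4 * k ^ 2 / D * (k ^ 2 - x - s * (rho * n))).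
  { intros s Hs; rewrite Hm; unfold a.
    replace (dot d d) with (rho ^ 2 + D) by (unfold D; ring).
    apply (eq_modulo _ _ (- n ^ 2) _ _ Hs). field; lra. }
  assert (HkD : 0 < 4 * k ^ 2 / D) by (apply Rdiv_lt_0_compat; lra).
  assert (Hp := Hkey 1 ltac:(lra)); assert (Hq := Hkey (-1) ltac:(lra)).
  clear Hkey Hm.
  split; intro H.
  - destruct (Rcase_abs (k ^ 2 - x)) as [L|L].
    + rewrite (Rabs_left _ L) in H.
      replace (k ^ 2 - x - -1 * (rho * n)) with 0 in Hq by lra.
      assert (E : (m - (n - 2 * a)) * (m - (2 * a - n)) = 0) by lra.
      apply Rmult_integral in E; destruct E as [E|E].
      * rewrite Rabs_pos_eq; lra.
      * lra.
    + rewrite (Rabs_right _ L) in H.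
      replace (k ^ 2 - x - 1 * (rho * n)) with 0 in Hp by lra.
      assert (m = n + 2 * a) by nra.
      rewrite Rabs_left; lra.
  - destruct (Rcase_abs (n - m)) as [L|L].
    + rewrite (Rabs_left _ L) in H.
      assert (E : k ^ 2 - x - 1 * (rho * n) = 0).
      { apply (Rmult_eq_reg_l (4 * k ^ 2 / D)); [|lra].
        replace m with (n + 2 * a) in Hp by lra; lra. }
      rewrite Rabs_pos_eq; nra.
    + rewrite (Rabs_right _ L) in H.
      assert (E : k ^ 2 - x - -1 * (rho * n) = 0).
      { apply (Rmult_eq_reg_l (4 * k ^ 2 / D)); [|lra].
        replace m with (n - 2 * a) in Hq by lra; lra. }
      rewrite Rabs_left1; nra.
Qed.

Lemma focal_parabola (M d : plane) (k rho : R) (S : plane -> Prop) :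
  0 < k -> 0 < rho -> dot d d = rho ^ 2 ->
  (forall X, S X <-> focal_eq M d k rho X) -> is_parabola S.
Proof.
  intros Hk Hrho Hd HS.
  assert (Hk2 : 0 < k ^ 2 / rho) by (apply Rdiv_lt_0_compat; nra).
  set (n := scal (/ rho) d).
  exists M, n, (dot n M + k ^ 2 / rho); split; [|split].
  - transitivity (pdist n zero).
    + unfold pdist; f_equal. apply plane_eq; unfold_plane; ring.
    + rewrite pdist_sqrt, <- sqrt_1; f_equal.
      transitivity (dot d d / rho ^ 2).
      * unfold n; unfold_plane; field; lra.
      * rewrite Hd; field; lra.
  - lra.
  - intro X; rewrite HS; unfold focal_eq.
    replace (dot n X - (dot n M + k ^ 2 / rho))
      with (- (k ^ 2 - dot d (minus X M)) / rho)
      by (unfold n; unfold_plane; field; lra).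
    unfold Rdiv; rewrite Rabs_mult, Rabs_Ropp, (Rabs_pos_eq (/ rho))
      by (left; apply Rinv_0_lt_compat; lra).
    split; intro H.
    + rewrite <- H; field; lra.
    + rewrite H; field; lra.
Qed.

(** * A conic is determined by five points of a focal conic *)

Definition poly_eval (p : list R) (x : R) : R :=
  fold_right (fun a y => a + x * y) 0 p.

Lemma poly_eval_factor (p : list R) (r : R) :
  exists q, length q = pred (length p) /\
    forall x, poly_eval p x = poly_eval p r + (x - r) * poly_eval q x.
Proof.
  induction p as [|a p (q & Hq & IH)].
  - exists []; split; [reflexivity | intro x; cbn; ring].
  - destruct p as [|b p].
    + exists []; split; [reflexivity | intro x; cbn; ring].
    + exists (poly_eval (b :: p) r :: q); split; [cbn in *; congruence|].
      intro x; change (a + x * poly_eval (b :: p) x =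
        a + r * poly_eval (b :: p) r
        + (x - r) * (poly_eval (b :: p) r + x * poly_eval q x)).
      rewrite IH; ring.
Qed.

Lemma poly_eval_many_roots (p xs : list R) :
  NoDup xs -> (length p <= length xs)%nat ->
  (forall x, In x xs -> poly_eval p x = 0) -> forall x, poly_eval p x = 0.
Proof.
  intro Hxs; revert p; induction Hxs as [|r xs Hr _ IH]; intros p Hl H0 x.
  - destruct p; [reflexivity | cbn in Hl; inversion Hl].
  - destruct (poly_eval_factor p r) as (q & Hq & Hf).
    rewrite Hf, (H0 r) by (left; reflexivity).
    rewrite (IH q); [ring | cbn in Hl; lia |].
    intros y Hy; assert (E := Hf y).
    rewrite !H0 in E by (cbn; tauto).
    apply (Rmult_eq_reg_l (y - r)); [lra|].
    intro Z; apply Hr; replace r with y by lra; exact Hy.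
Qed.

Definition quad (a b c d e f : R) (p : plane) : R :=
  a * fst p ^ 2 + b * (fst p * snd p) + c * snd p ^ 2
  + d * fst p + e * snd p + f.

(** Stereographic projection from (1, 0), which lies on the conic by the last
    hypothesis, turns the restriction of the quadratic polynomial to the circle
    into a polynomial of degree at most 3; four roots force it to vanish. *)
Lemma quad_vanishing_on_circle_aux (a b c d e f : R) (ps : list plane) :
  NoDup ps -> length ps = 4%nat ->
  (forall p, In p ps -> dot p p = 1 /\ fst p <> 1 /\ quad a b c d e f p = 0) ->
  a + d + f = 0 ->
  c = a /\ f = - a /\ b = 0 /\ d = 0 /\ e = 0.
Proof.
  intros Hnd Hl Hp H1.
  set (x := fun p : plane => snd p / (1 - fst p)).
  assert (Hx : forall p, In p ps -> 1 - fst p <> 0 /\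
            1 - fst p = 2 / (x p ^ 2 + 1) /\ snd p = x p * (1 - fst p)).
  { intros p Hin; destruct (Hp p Hin) as (Hu & Hne & _); unfold dot in Hu.
    assert (Hne' : 1 - fst p <> 0) by lra.
    assert (Hs : snd p = x p * (1 - fst p)) by (unfold x; field; exact Hne').
    split; [exact Hne' | split; [|exact Hs]].
    rewrite Hs in Hu.
    assert (E : (1 - fst p) * ((x p ^ 2 + 1) * (1 - fst p) - 2) = 0) by lra.
    apply Rmult_integral in E; destruct E as [E|E]; [lra|].
    assert (x p ^ 2 + 1 <> 0) by nra.
    apply (Rmult_eq_reg_l (x p ^ 2 + 1)); [|assumption].
    field_simplify; [lra | assumption]. }
  assert (Hxs : NoDup (map x ps)).
  { apply NoDup_map_NoDup_ForallPairs; [|exact Hnd].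
    intros p q Hip Hiq E.
    destruct (Hx p Hip) as (_ & E1 & E2); destruct (Hx q Hiq) as (_ & E3 & E4).
    rewrite E in E1, E2.
    apply plane_eq; [lra|]. rewrite E2, E4, E1, E3; reflexivity. }
  (* The projection is x = snd p / (1 - fst p), so that p has the coordinates
     (x^2 - 1) / (x^2 + 1) and 2 x / (x^2 + 1).  The coefficient a + d + f of x^4
     is zero. *)
  assert (H0 := poly_eval_many_roots
    [a - d + f; 2 * (e - b); 4 * c - 2 * a + 2 * f; 2 * (b + e)] _ Hxs).
  rewrite length_map, Hl in H0; specialize (H0 (le_n _)).
  assert (Hz : forall y, poly_eval
    [a - d + f; 2 * (e - b); 4 * c - 2 * a + 2 * f; 2 * (b + e)] y = 0).
  { apply H0; intros y Hy; apply in_map_iff in Hy.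
    destruct Hy as (p & <- & Hin).
    destruct (Hx p Hin) as (Hne & E1 & E2).
    destruct (Hp p Hin) as (_ & _ & Hq).
    unfold quad in Hq; cbn.
    rewrite E2 in Hq. replace (fst p) with (1 - 2 / (x p ^ 2 + 1)) in Hq by lra.
    assert (x p ^ 2 + 1 <> 0) by nra.
    apply (Rmult_eq_reg_r (/ (x p ^ 2 + 1) ^ 2));
      [| apply Rinv_neq_0_compat, pow_nonzero; assumption].
    rewrite Rmult_0_l; etransitivity; [|exact Hq].
    replace f with (- a - d) by lra; field; assumption. }
  generalize (Hz 0) (Hz 1) (Hz (-1)) (Hz 2); unfold poly_eval; cbn.
  intros; repeat split; lra.
Qed.

(** One of the five points is rotated to (1, 0), to serve as the centre of the
    projection. *)
Lemma quad_vanishing_on_circle (a b c d e f : R) (ps : list plane) :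
  NoDup ps -> length ps = 5%nat ->
  (forall p, In p ps -> dot p p = 1 /\ quad a b c d e f p = 0) ->
  c = a /\ f = - a /\ b = 0 /\ d = 0 /\ e = 0.
Proof.
  intros Hnd Hl Hp.
  destruct ps as [|[x y] ps]; [discriminate|].
  inversion Hnd as [|? ? Hni Hnd']; subst.
  destruct (Hp (x, y)) as [Hu Hq]; [left; reflexivity|].
  unfold dot in Hu; unfold quad in Hq; cbn in Hu, Hq.
  (* The rotation that takes the first point to (1, 0). *)
  set (rot := fun p : plane =>
    (x * fst p + y * snd p, x * snd p - y * fst p) : plane).
  assert (Hrot : forall p, p = (x * fst (rot p) - y * snd (rot p),
                                x * snd (rot p) + y * fst (rot p))).
  { intro p; unfold rot; cbn; apply plane_eq; cbn.
    - transitivity ((x * x + y * y) * fst p); [rewrite Hu|]; ring.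
    - transitivity ((x * x + y * y) * snd p); [rewrite Hu|]; ring. }
  destruct (quad_vanishing_on_circle_aux
    (a * x ^ 2 + b * (x * y) + c * y ^ 2)
    (2 * (c - a) * (x * y) + b * (x ^ 2 - y ^ 2))
    (a * y ^ 2 - b * (x * y) + c * x ^ 2)
    (d * x + e * y) (e * x - d * y) f (map rot ps))
    as (E1 & E2 & E3 & E4 & E5).
  - apply NoDup_map_NoDup_ForallPairs; [|exact Hnd'].
    intros p q _ _ E; rewrite (Hrot p), (Hrot q), E; reflexivity.
  - rewrite length_map; cbn in Hl; congruence.
  - intros p' Hin'; apply in_map_iff in Hin'; destruct Hin' as (p & <- & Hin).
    destruct (Hp p) as [Hup Hqp]; [right; exact Hin|].
    assert (Hur : dot (rot p) (rot p) = 1).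
    { transitivity ((x * x + y * y) * dot p p);
        [unfold rot, dot; cbn; ring | rewrite Hu, Hup; ring]. }
    split; [exact Hur | split].
    + intro E; unfold dot in Hur; rewrite E in Hur.
      assert (E0 : snd (rot p) = 0) by nra.
      apply Hni; rewrite (Hrot p), E, E0 in Hin.
      replace x with (x * 1 - y * 0) by ring.
      replace y with (x * 0 + y * 1) at 2 by ring; exact Hin.
    + rewrite (Hrot p) in Hqp; unfold quad in *; cbn [fst snd] in *.
      rewrite <- Hqp; ring.
  - rewrite <- Hq; ring.
  - clear Hp Hnd Hnd' Hrot Hl Hni. clear rot Hq.
    assert (Hd : d = 0).
    { transitivity (x * (d * x + e * y) - y * (e * x - d * y));
        [| rewrite E4, E5; ring].
      transitivity ((x * x + y * y) * d); [rewrite Hu|]; ring. }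
    assert (He : e = 0).
    { transitivity (y * (d * x + e * y) + x * (e * x - d * y));
        [| rewrite E4, E5; ring].
      transitivity ((x * x + y * y) * e); [rewrite Hu|]; ring. }
    assert (E6 : (c - a) * (x * x - y * y) = 2 * b * (x * y)) by lra.
    assert (E7 : 2 * (c - a) * (x * y) + b * (x * x - y * y) = 0) by lra.
    assert (Hca : c - a = 0).
    { transitivity ((x * x + y * y) ^ 2 * (c - a)); [rewrite Hu; ring|].
      transitivity ((x * x - y * y) * ((c - a) * (x * x - y * y))
        + 2 * (x * y) * (2 * (c - a) * (x * y))); [ring|].
      replace (2 * (c - a) * (x * y)) with (- (b * (x * x - y * y))) by lra.
      rewrite E6; ring. }
    assert (Hb : b = 0).
    { transitivity ((x * x + y * y) ^ 2 * b); [rewrite Hu; ring|].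
      replace c with a in E6, E7 by lra.
      transitivity ((x * x - y * y) * (b * (x * x - y * y))
        + 2 * (x * y) * (2 * b * (x * y))); [ring|].
      rewrite <- E6; replace (b * (x * x - y * y)) with 0 by lra; ring. }
    repeat split; try assumption; [lra|].
    rewrite E2, Hb; replace c with a by lra.
    transitivity (- a * (x * x + y * y)); [ring | rewrite Hu; ring].
Qed.

Lemma focal_eq_sq (M d : plane) (k rho : R) (X : plane) :
  0 < rho ->
  focal_eq M d k rho X <->
  rho ^ 2 * dot (minus X M) (minus X M) = (k ^ 2 - dot d (minus X M)) ^ 2.
Proof.
  intro Hrho; unfold focal_eq.
  assert (H := pdist_sq X M); assert (H0 := pdist_ge0 X M).
  rewrite <- H; set (n := pdist X M) in *; set (g := k ^ 2 - _).
  clearbody n g; split; intro E.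
  - rewrite <- (pow2_abs g), <- E; ring.
  - rewrite <- (Rabs_pos_eq (rho * n)) by nra.
    apply Rsqr_eq_abs_0; unfold Rsqr; lra.
Qed.

(** The map [u] below sends a point of the focal conic to the normal of its polar;
    it is the restriction of a projective transformation, so it carries the conic
    [S] to another quadratic equation, to which [quad_vanishing_on_circle]
    applies. *)
Lemma conic_through_five_points (M d : plane) (k rho : R) (S : plane -> Prop)
  (Xs : list plane) :
  0 < k -> 0 < rho -> is_conic S ->
  NoDup Xs -> length Xs = 5%nat ->
  (forall X, In X Xs -> S X /\ focal_eq M d k rho X) ->
  forall X, S X <-> focal_eq M d k rho X.
Proof.
  intros Hk Hrho (a & b & c & d' & e & f & Habc & HS) Hnd Hl HX.
  assert (Hk2 : 0 < k ^ 2) by nra.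
  set (g := fun X => k ^ 2 - dot d (minus X M)).
  set (u := fun X : plane => scal (rho / g X) (minus X M) : plane).
  assert (Hg : forall X, focal_eq M d k rho X -> g X <> 0 /\
             dot (u X) (u X) = 1 /\ g X * (rho + dot d (u X)) = rho * k ^ 2).
  { intros X HXf; rewrite focal_eq_sq in HXf by exact Hrho.
    change (rho ^ 2 * dot (minus X M) (minus X M) = g X ^ 2) in HXf.
    assert (Hg : g X <> 0).
    { intro E; rewrite E in HXf.
      assert (E0 : dot (minus X M) (minus X M) = 0).
      { apply (Rmult_eq_reg_l (rho ^ 2)); [lra | apply pow_nonzero; lra]. }
      apply Rplus_sqr_eq_0 in E0; destruct E0 as [E1 E2].
      unfold g, dot in E; rewrite E1, E2 in E; lra. }
    split; [exact Hg | split].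
    - transitivity (rho ^ 2 * dot (minus X M) (minus X M) / g X ^ 2).
      + unfold u; unfold_plane; field; exact Hg.
      + rewrite HXf; field; exact Hg.
    - transitivity (rho * (g X + dot d (minus X M))).
      + unfold u; unfold_plane; field; exact Hg.
      + unfold g; ring. }
  (* The conic translated to M has coefficients a, b, c, D, E, F. *)
  set (D := 2 * a * fst M + b * snd M + d').
  set (E := b * fst M + 2 * c * snd M + e).
  set (F := quad a b c d' e f M).
  assert (HF : forall w : plane,
    quad a b c d' e f (plus M w) = quad a b c D E F w).
  { intro w; unfold quad, D, E, F, quad; unfold_plane; ring. }
  assert (HS' : forall X, S X <-> quad a b c D E F (minus X M) = 0).
  { intro X; rewrite <- HF, HS.
    replace (plus M (minus X M)) with X by (apply plane_eq; unfold_plane; ring).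
    reflexivity. }
  clearbody D E F; clear HF HS.
  destruct (quad_vanishing_on_circle
    (k ^ 4 * a + k ^ 2 * (D * fst d) + F * fst d ^ 2)
    (k ^ 4 * b + k ^ 2 * (D * snd d + E * fst d) + 2 * F * (fst d * snd d))
    (k ^ 4 * c + k ^ 2 * (E * snd d) + F * snd d ^ 2)
    (rho * (k ^ 2 * D + 2 * F * fst d)) (rho * (k ^ 2 * E + 2 * F * snd d))
    (rho ^ 2 * F) (map u Xs)) as (E1 & E2 & E3 & E4 & E5).
  - apply NoDup_map_NoDup_ForallPairs; [|exact Hnd].
    intros X Y HinX HinY Eu.
    destruct (Hg X (proj2 (HX X HinX))) as (HX1 & _ & HX2).
    destruct (Hg Y (proj2 (HX Y HinY))) as (HY1 & _ & HY2).
    assert (Eg : g X = g Y).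
    { rewrite Eu, <- HY2 in HX2.
      apply Rmult_eq_reg_r in HX2; [exact HX2|].
      intro Z; rewrite Z in HY2; nra. }
    unfold u in Eu; rewrite Eg in Eu.
    generalize (f_equal fst Eu) (f_equal snd Eu); unfold_plane; intros F1 F2.
    assert (Hq : rho / g Y <> 0).
    { apply Rmult_integral_contrapositive_currified;
        [lra | apply Rinv_neq_0_compat; exact HY1]. }
    apply Rmult_eq_reg_l in F1; [|exact Hq].
    apply Rmult_eq_reg_l in F2; [|exact Hq].
    apply plane_eq; lra.
  - rewrite length_map; exact Hl.
  - intros p Hin; apply in_map_iff in Hin; destruct Hin as (X & <- & Hin).
    destruct (HX X Hin) as (HSX & HfX); rewrite HS' in HSX.
    destruct (Hg X HfX) as (Hg0 & Hu & Hh); split; [exact Hu|].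
    set (h := rho + dot d (u X)) in *.
    assert (Ew : minus X M = scal (g X / rho) (u X)).
    { unfold u; apply plane_eq; unfold_plane; field; split; lra. }
    rewrite Ew in HSX; replace (g X / rho) with (k ^ 2 / h) in HSX.
    2:{ assert (h <> 0) by (intro Z; rewrite Z in Hh; nra).
        apply (Rmult_eq_reg_l (h * rho)); [|nra].
        field_simplify; lra. }
    assert (Hh0 : h <> 0) by (intro Z; rewrite Z in Hh; nra).
    transitivity (h ^ 2 * quad a b c D E F (scal (k ^ 2 / h) (u X)));
      [|rewrite HSX; ring].
    transitivity (k ^ 4 * (a * fst (u X) ^ 2 + b * (fst (u X) * snd (u X))
       + c * snd (u X) ^ 2) + k ^ 2 * h * (D * fst (u X) + E * snd (u X))
       + F * h ^ 2); [unfold quad, h, dot; ring |].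
    clearbody h; generalize (u X); intro v.
    unfold quad; unfold_plane; field; exact Hh0.
  (* Reading the transformed coefficients backwards: the equation of S is a
     multiple of that of the focal conic, with factor F / k^4. *)
  - assert (Ed : k ^ 2 * D = - 2 * F * fst d) by (apply (Rmult_eq_reg_l rho); lra).
    assert (Ee : k ^ 2 * E = - 2 * F * snd d) by (apply (Rmult_eq_reg_l rho); lra).
    assert (Ea : k ^ 4 * a = F * (fst d ^ 2 - rho ^ 2)).
    { replace (k ^ 2 * (D * fst d)) with (k ^ 2 * D * fst d) in E2 by ring.
      rewrite Ed in E2; lra. }
    assert (Ec : k ^ 4 * c = F * (snd d ^ 2 - rho ^ 2)).
    { replace (k ^ 2 * (E * snd d)) with (k ^ 2 * E * snd d) in E1 by ring.
      rewrite Ee in E1; lra. }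
    assert (Eb : k ^ 4 * b = 2 * F * (fst d * snd d)).
    { replace (k ^ 2 * (D * snd d + E * fst d))
        with (k ^ 2 * D * snd d + k ^ 2 * E * fst d) in E3 by ring.
      rewrite Ed, Ee in E3; lra. }
    assert (Hk4 : k ^ 4 <> 0) by (apply pow_nonzero; lra).
    assert (HF : F <> 0).
    { intro Z; rewrite Z in Ea, Eb, Ec; apply Habc.
      repeat split; apply (Rmult_eq_reg_l (k ^ 4)); lra. }
    intro X; rewrite HS', focal_eq_sq by exact Hrho.
    set (w := minus X M : plane).
    assert (Hquad : k ^ 4 * quad a b c D E F w =
      F * ((k ^ 2 - dot d w) ^ 2 - rho ^ 2 * dot w w)).
    { transitivity (k ^ 4 * a * fst w ^ 2 + k ^ 4 * b * (fst w * snd w)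
        + k ^ 4 * c * snd w ^ 2 + k ^ 2 * (k ^ 2 * D) * fst w
        + k ^ 2 * (k ^ 2 * E) * snd w + k ^ 4 * F); [unfold quad; ring|].
      rewrite Ea, Eb, Ec, Ed, Ee; unfold dot; ring. }
    split; intro Z.
    + rewrite Z, Rmult_0_r in Hquad; symmetry in Hquad.
      apply Rmult_integral in Hquad; destruct Hquad; [contradiction | lra].
    + apply (Rmult_eq_reg_l (k ^ 4)); [|exact Hk4].
      fold w in Z; rewrite Hquad, Z; ring.
Qed.

(** * Negative pedal curves and inversion *)

Lemma is_derive_dot (f g : R -> plane) (t : R) (f' g' : plane) :
  is_derive f t f' -> is_derive g t g' ->
  is_derive (fun s => dot (f s) (g s)) t (dot f' (g t) + dot (f t) g').
Proof.
  intros Hf Hg.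
  assert (Hprod : forall x y : R -> R, forall x' y' : R,
    is_derive x t x' -> is_derive y t y' ->
    is_derive (fun s => x s * y s) t (x' * y t + x t * y')).
  { intros x y x' y' Hx Hy; exact (is_derive_mult x y t x' y' Hx Hy Rmult_comm). }
  replace (dot f' (g t) + dot (f t) g') with
    (plus (fst f' * fst (g t) + fst (f t) * fst g')
          (snd f' * snd (g t) + snd (f t) * snd g'))
    by (unfold dot, plus; cbn; ring).
  refine (is_derive_plus _ _ _ _ _ (Hprod _ _ _ _ _ _) (Hprod _ _ _ _ _ _)).
  - exact (is_derive_fst _ _ _ Hf).
  - exact (is_derive_fst _ _ _ Hg).
  - exact (is_derive_snd _ _ _ Hf).
  - exact (is_derive_snd _ _ _ Hg).
Qed.

Lemma is_derive_minus_const (f : R -> plane) (t : R) (f' Q : plane) :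
  is_derive f t f' -> is_derive (fun s => minus (f s) Q) t f'.
Proof.
  intro Hf.
  replace f' with (minus f' zero) by (apply plane_eq; unfold_plane; ring).
  exact (is_derive_minus _ _ _ _ _ Hf (is_derive_const Q t)).
Qed.

(** Removes the derivative from the definition: with v the velocity, the function
    that is differentiated there has derivative (X - M) . v - 2 (gamma t - M) . v. *)
Lemma neg_pedal_image_char (gamma : R -> plane) (M X v : plane) (t : R) :
  is_derive gamma t v ->
  neg_pedal_image gamma M t X <->
  gamma t <> M /\ dot (minus X (gamma t)) (minus (gamma t) M) = 0 /\
  dot (minus X M) v = 2 * dot (minus (gamma t) M) v.
Proof.
  intro Hv.
  assert (Hd : is_derive (fun s => dot (minus X (gamma s)) (minus (gamma s) M)) t
                 (dot (minus X M) v - 2 * dot (minus (gamma t) M) v)).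
  { assert (Hg := is_derive_minus_const _ _ _ M Hv).
    assert (Hn := is_derive_dot _ _ _ _ _ Hg Hg).
    assert (Hl := is_derive_dot _ _ _ _ _ (is_derive_const (minus X M) t) Hg).
    cbv beta in Hn, Hl.
    apply (is_derive_ext (fun s => minus
      (dot (minus X M) (minus (gamma s) M))
      (dot (minus (gamma s) M) (minus (gamma s) M)))).
    { intro s; unfold_plane; ring. }
    replace (dot (minus X M) v - 2 * dot (minus (gamma t) M) v) with
      (minus (dot zero (minus (gamma t) M) + dot (minus X M) v)
         (dot v (minus (gamma t) M) + dot (minus (gamma t) M) v))
      by (unfold_plane; ring).
    exact (is_derive_minus _ _ _ _ _ Hl Hn). }
  unfold neg_pedal_image; split; intros (H1 & H2 & H3);
    split; [assumption | split; [assumption |] | assumption | split; [assumption |]].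
  - generalize (is_derive_unique _ _ _ Hd).
    rewrite (is_derive_unique _ _ _ H3); lra.
  - rewrite H3, Rminus_diag in Hd; exact Hd.
Qed.

(** The negative pedal curve is the polar-dual of the inverse curve: [X] is the pole
    of the tangent of the inverse curve at the same parameter.  With
    g = gamma t - M, the inverse point is M + (k^2 / |g|^2) g.  The two equations
    of the image are (X - M) . g = |g|^2 and (X - M) . v = 2 g . v, the second
    being the derivative of the first with [X] fixed; so the quotient
    (X - M) . g / |g|^2 is 1 to first order, and the inverse curve stays on the
    polar of [X] to first order. *)
Lemma tangent_inversion_polar (gamma : R -> plane) (M X Y v : plane) (k t : R) :
  is_derive gamma t v ->
  neg_pedal_image gamma M t X ->
  tangent_line (fun s => inversion M k (gamma s)) t Y ->
  polar M k X Y.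
Proof.
  intros Hv HX (v' & s & Hv' & _ & ->).
  apply (neg_pedal_image_char _ _ _ _ _ Hv) in HX.
  destruct HX as (Hne & H1 & H2).
  set (N := fun s => dot (minus (gamma s) M) (minus (gamma s) M)).
  assert (HN : N t <> 0).
  { intro E; apply Rplus_sqr_eq_0 in E; destruct E as [E1 E2].
    apply Hne, plane_eq; unfold_plane; lra. }
  assert (Hinv : forall s, dot (minus X M) (minus (inversion M k (gamma s)) M)
    = k ^ 2 / N s * dot (minus X M) (minus (gamma s) M)).
  { intro s'; unfold inversion; rewrite pdist_sq; fold (N s').
    generalize (k ^ 2 / N s'); intro q; unfold_plane; ring. }
  assert (HXg : dot (minus X M) (minus (gamma t) M) = N t)
    by (unfold N; unfold_plane; lra).
  assert (Hg := is_derive_minus_const _ _ _ M Hv).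
  assert (Hl := is_derive_dot _ _ _ _ _ (is_derive_const (minus X M) t) Hg).
  assert (Hn := is_derive_dot _ _ _ _ _ Hg Hg).
  cbv beta in Hl, Hn; fold N in Hn.
  assert (Hd : is_derive (fun s => k ^ 2 / N s * dot (minus X M) (minus (gamma s) M))
                 t 0).
  { set (L := fun s => dot (minus X M) (minus (gamma s) M)) in *.
    apply (is_derive_ext (fun s => k ^ 2 * (L s / N s)));
      [intro s'; change (k ^ 2 * (L s' / N s') = k ^ 2 / N s' * L s' :> R);
       unfold Rdiv; ring|].
    assert (Hq := is_derive_scal _ _ (k ^ 2) _ (is_derive_div _ _ _ _ _ Hl Hn HN)).
    replace 0 with (k ^ 2 * (((dot zero (minus (gamma t) M) + dot (minus X M) v) * N t
      - L t * (dot v (minus (gamma t) M) + dot (minus (gamma t) M) v)) / N t ^ 2));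
      [exact Hq|].
    unfold L; rewrite HXg, H2.
    replace (dot v (minus (gamma t) M)) with (dot (minus (gamma t) M) v)
      by (unfold dot; ring).
    replace (dot zero (minus (gamma t) M)) with 0 by (unfold_plane; ring).
    field; exact HN. }
  assert (Hd' : is_derive (fun s => k ^ 2 / N s * dot (minus X M) (minus (gamma s) M))
                 t (dot (minus X M) v')).
  { apply (is_derive_ext
      (fun s => dot (minus X M) (minus (inversion M k (gamma s)) M)) _ _ _ Hinv).
    assert (Hq := is_derive_dot _ _ _ _ _ (is_derive_const (minus X M) t)
                    (is_derive_minus_const _ _ _ M Hv')).
    cbv beta in Hq.
    replace (dot (minus X M) v') with
      (dot zero (minus (inversion M k (gamma t)) M) + dot (minus X M) v');
      [exact Hq | unfold dot, zero; cbn; ring]. }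
  assert (E : dot (minus X M) v' = 0).
  { rewrite <- (is_derive_unique _ _ _ Hd'); exact (is_derive_unique _ _ _ Hd). }
  unfold polar.
  transitivity (dot (minus X M) (minus (inversion M k (gamma t)) M)
                + s * dot (minus X M) v').
  - generalize (inversion M k (gamma t)); intro; unfold_plane; ring.
  - rewrite E, Hinv, HXg; field; exact HN.
Qed.

Lemma is_derive_arc60 (C A B : plane) (t : R) :
  is_derive (arc60 C A B) t
    (plus (scal (- cos (PI / 3 - t) / sin (PI / 3)) (minus A C))
          (scal (cos t / sin (PI / 3)) (minus B C))).
Proof.
  assert (H := sin_PI3_neq0).
  apply (is_derive_ext (fun t =>
    (fst C + (sin (PI / 3 - t) / sin (PI / 3) * (fst A - fst C)
              + sin t / sin (PI / 3) * (fst B - fst C)),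
     snd C + (sin (PI / 3 - t) / sin (PI / 3) * (snd A - snd C)
              + sin t / sin (PI / 3) * (snd B - snd C))) : plane)).
  { intro s; unfold arc60; apply plane_eq; unfold_plane; ring. }
  match goal with |- is_derive _ _ ?v => rewrite (surjective_pairing v) end.
  apply is_derive_coords; auto_derive; trivial; unfold_plane; unfold Rminus;
    field; exact H.
Qed.

Lemma neg_pedal_arc60_start (C A B M X : plane) :
  neg_pedal_image (arc60 C A B) M 0 X <->
  A <> M /\ dot (minus X A) (minus A M) = 0 /\
  dot (minus X M) (minus B C) - dot (minus X M) (minus A C) / 2 =
  2 * dot (minus A M) (minus B C) - dot (minus A M) (minus A C).
Proof.
  rewrite (neg_pedal_image_char _ _ _ _ _ (is_derive_arc60 C A B 0)).
  rewrite arc60_start, Rminus_0_r, cos_0, cos_PI3.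
  assert (H := sin_PI3_neq0); set (s := sin (PI / 3)) in *; clearbody s.
  assert (E : forall w : plane,
    dot w (plus (scal (- (1 / 2) / s) (minus A C)) (scal (1 / s) (minus B C))) =
    (dot w (minus B C) - dot w (minus A C) / 2) / s).
  { intro w; unfold_plane; field; exact H. }
  rewrite !E; split; intros (H1 & H2 & H3); (split; [assumption | split; [assumption|]]).
  - apply (Rmult_eq_compat_r s) in H3; field_simplify in H3; try assumption; lra.
  - rewrite H3; field; exact H.
Qed.

Lemma neg_pedal_arc60_end (C A B M X : plane) :
  neg_pedal_image (arc60 C A B) M (PI / 3) X <->
  B <> M /\ dot (minus X B) (minus B M) = 0 /\
  dot (minus X M) (minus B C) / 2 - dot (minus X M) (minus A C) =
  dot (minus B M) (minus B C) - 2 * dot (minus B M) (minus A C).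
Proof.
  rewrite (neg_pedal_image_char _ _ _ _ _ (is_derive_arc60 C A B (PI / 3))).
  rewrite arc60_end, Rminus_diag, cos_0, cos_PI3.
  assert (H := sin_PI3_neq0); set (s := sin (PI / 3)) in *; clearbody s.
  assert (E : forall w : plane,
    dot w (plus (scal (- 1 / s) (minus A C)) (scal (1 / 2 / s) (minus B C))) =
    (dot w (minus B C) / 2 - dot w (minus A C)) / s).
  { intro w; unfold_plane; field; exact H. }
  rewrite !E; split; intros (H1 & H2 & H3); (split; [assumption | split; [assumption|]]).
  - apply (Rmult_eq_compat_r s) in H3; field_simplify in H3; try assumption; lra.
  - rewrite H3; field; exact H.
Qed.

(** * The excircle of an equilateral triangle *)

Lemma tangent_to_circle_foot (L : plane -> Prop) (c T : plane) (rho : R) :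
  0 < rho -> tangent_to_circle_at L c rho T ->
  dot (minus T c) (minus T c) = rho ^ 2 /\
  forall Y, L Y -> dot (minus Y c) (minus T c) = rho ^ 2.
Proof.
  intros Hrho (t & <- & HL).
  assert (Hu := unit_vec_dot t).
  assert (E : minus (circle_curve c rho t) c = scal rho (unit_vec t))
    by (apply plane_eq; unfold circle_curve, unit_vec; unfold_plane; ring).
  rewrite E; split.
  - transitivity (rho ^ 2 * dot (unit_vec t) (unit_vec t)).
    + unfold dot, scal; cbn; unfold scal, mult; cbn; unfold mult; cbn; ring.
    + rewrite Hu; ring.
  - intros Y HY; apply HL in HY.
    rewrite tangent_line_circle in HY by exact Hrho.
    transitivity (rho * dot (minus Y c) (unit_vec t)).
    + unfold dot, scal; cbn; unfold scal, mult; cbn; unfold mult; cbn; ring.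
    + rewrite HY; ring.
Qed.

Lemma linear_system_unique (a b c d x y x0 y0 : R) :
  a * x + b * y = a * x0 + b * y0 -> c * x + d * y = c * x0 + d * y0 ->
  a * d - b * c <> 0 -> x = x0 /\ y = y0.
Proof.
  intros H1 H2 H; split; apply (Rmult_eq_reg_l (a * d - b * c)); try exact H.
  - transitivity (d * (a * x + b * y) - b * (c * x + d * y)); [ring|].
    rewrite H1, H2; ring.
  - transitivity (a * (c * x + d * y) - c * (a * x + b * y)); [ring|].
    rewrite H1, H2; ring.
Qed.

Lemma line_left (A B : plane) : line A B A.
Proof. exists 0; apply plane_eq; unfold_plane; ring. Qed.

Lemma line_right (A B : plane) : line A B B.
Proof. exists 1; apply plane_eq; unfold_plane; ring. Qed.

(** Equality of the two tangent segments from each vertex forces the contact points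
    to be the midpoint of AB and the points at 3/2 of the length on the rays OA
    and OB.  The radii at the last two are perpendicular to OA and OB, and these
    two linear conditions on the centre have the unique solution A + B - O, the
    reflection of O in AB. *)
Lemma equilateral_excircle (l rho : R) (A O B c : plane) :
  0 < l -> equilateral l A O B -> excircle A O B c rho ->
  c = plus A (minus B O) /\ rho ^ 2 = 3 / 4 * l ^ 2.
Proof.
  intros Hl (HAO & HOB & HBA)
    (Hrho & (s1 & Hs1 & H1) & (s2 & Hs2 & H2) & (s3 & Hs3 & H3)).
  assert (Hll : 0 < l * l) by nra.
  apply (f_equal (fun x : R => x ^ 2)) in HAO, HOB, HBA.
  rewrite pdist_sq in HAO, HOB, HBA.
  apply (tangent_to_circle_foot _ _ _ _ Hrho) in H1, H2, H3.
  destruct H1 as [T1 H1], H2 as [T2 H2], H3 as [T3 H3].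
  assert (H1A := H1 A (line_left _ _)); assert (H1B := H1 B (line_right _ _)).
  assert (H2O := H2 O (line_left _ _)); assert (H2A := H2 A (line_right _ _)).
  assert (H3O := H3 O (line_left _ _)); assert (H3B := H3 B (line_right _ _)).
  clear H1 H2 H3.
  (* Squared tangent lengths from the vertices. *)
  assert (LA1 : s1 ^ 2 * l ^ 2 = dot (minus A c) (minus A c) - rho ^ 2).
  { rewrite <- HBA; unfold_plane; lra. }
  assert (LB1 : (1 - s1) ^ 2 * l ^ 2 = dot (minus B c) (minus B c) - rho ^ 2).
  { rewrite <- HBA; unfold_plane; lra. }
  assert (LA2 : (s2 - 1) ^ 2 * l ^ 2 = dot (minus A c) (minus A c) - rho ^ 2).
  { rewrite <- HAO; unfold_plane; lra. }
  assert (LO2 : s2 ^ 2 * l ^ 2 = dot (minus O c) (minus O c) - rho ^ 2).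
  { rewrite <- HAO; unfold_plane; lra. }
  assert (LB3 : (s3 - 1) ^ 2 * l ^ 2 = dot (minus B c) (minus B c) - rho ^ 2).
  { rewrite <- HOB; unfold_plane; lra. }
  assert (LO3 : s3 ^ 2 * l ^ 2 = dot (minus O c) (minus O c) - rho ^ 2).
  { rewrite <- HOB; unfold_plane; lra. }
  assert (Hsq : forall x y : R, 0 <= x -> 0 <= y ->
                  x ^ 2 * l ^ 2 = y ^ 2 * l ^ 2 -> x = y).
  { intros x y Hx Hy E.
    assert (E' : (x - y) * (x + y) = 0)
      by (apply (Rmult_eq_reg_r (l * l)); lra).
    apply Rmult_integral in E'; destruct E'; lra. }
  assert (E1 : s1 = s2 - 1) by (apply Hsq; lra).
  assert (E2 : 1 - s1 = s3 - 1) by (apply Hsq; lra).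
  assert (E3 : s2 = s3) by (apply Hsq; lra).
  assert (s1 = 1 / 2) by lra; assert (s2 = 3 / 2) by lra; assert (s3 = 3 / 2) by lra.
  clear LA1 LB1 LA2 LO2 LB3 LO3 Hsq E1 E2 E3 Hs1 Hs2 Hs3; subst s1 s2 s3.
  destruct (linear_system_unique
    (fst A - fst O) (snd A - snd O) (fst B - fst O) (snd B - snd O)
    (fst c - (fst A + (fst B - fst O))) (snd c - (snd A + (snd B - snd O))) 0 0)
    as [Z1 Z2].
  - unfold_plane; lra.
  - unfold_plane; lra.
  - intro E.
    assert (G : ((fst A - fst O) * (snd B - snd O)
                 - (snd A - snd O) * (fst B - fst O)) ^ 2 = 3 / 4 * l ^ 2 * l ^ 2).
    { assert (HD : dot (minus A O) (minus O B) = - (l ^ 2) / 2)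
        by (unfold_plane; lra).
      transitivity (dot (minus A O) (minus A O) * dot (minus O B) (minus O B)
                    - dot (minus A O) (minus O B) ^ 2); [unfold_plane; ring|].
      rewrite HAO, HOB, HD; field. }
    rewrite E in G; nra.
  - assert (Hc : c = plus A (minus B O)) by (apply plane_eq; unfold_plane; lra).
    split; [exact Hc|].
    rewrite <- T1; subst c; unfold_plane; lra.
Qed.

(** * Coordinates adapted to the Reuleaux triangle *)

(** Coordinates with respect to e and q J e, where J is the quarter turn.  With
    q = +-sqrt 3 (only q^2 = 3 is ever used) all points of the configuration have
    rational coordinates, and the sign of q covers both orientations of the
    triangle.  The origin [O] is a separate variable so that M itself can be
    written as the point with coordinates (0, 0). *)
Definition frame (O e : plane) (q x y : R) : plane :=
  plus O ((x * fst e - q * y * snd e, x * snd e + q * y * fst e) : plane).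

Lemma frame_dot (O e : plane) (r q x1 y1 x2 y2 x3 y3 x4 y4 : R) :
  q * q = 3 -> dot e e = r ^ 2 ->
  dot (minus (frame O e q x1 y1) (frame O e q x2 y2))
      (minus (frame O e q x3 y3) (frame O e q x4 y4)) =
  r ^ 2 * ((x1 - x2) * (x3 - x4) + 3 * ((y1 - y2) * (y3 - y4))).
Proof.
  intros Hq He; rewrite <- He, <- Hq; unfold frame; unfold_plane; ring.
Qed.

Lemma frame_coords (O e : plane) (r q : R) (X : plane) :
  0 < r -> q * q = 3 -> dot e e = r ^ 2 -> exists x y, X = frame O e q x y.
Proof.
  intros Hr Hq He.
  assert (He' : dot e e <> 0) by (rewrite He; apply pow_nonzero; lra).
  exists (dot (minus X O) e / dot e e),
    (q / 3 * ((snd X - snd O) * fst e - (fst X - fst O) * snd e) / dot e e).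
  unfold frame; apply plane_eq; unfold_plane.
  - apply (eq_modulo _ _ (((snd X - snd O) * fst e - (fst X - fst O) * snd e)
       * snd e / (3 * (fst e * fst e + snd e * snd e))) _ _ Hq).
    field; exact He'.
  - apply (eq_modulo _ _ (- ((snd X - snd O) * fst e - (fst X - fst O) * snd e)
       * fst e / (3 * (fst e * fst e + snd e * snd e))) _ _ Hq).
    field; exact He'.
Qed.

Lemma frame_inj (O e : plane) (r q x y x' y' : R) :
  0 < r -> q * q = 3 -> dot e e = r ^ 2 ->
  frame O e q x y = frame O e q x' y' -> x = x' /\ y = y'.
Proof.
  intros Hr Hq He E.
  assert (H := frame_dot O e r q x y x' y' x y x' y' Hq He).
  rewrite E in H.
  assert (Hr2 : 0 < r * r) by nra.
  assert (H' : (x - x') * (x - x') + 3 * ((y - y') * (y - y')) = 0).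
  { apply (Rmult_eq_reg_l (r * r)); [|lra].
    transitivity (r ^ 2 * ((x - x') * (x - x') + 3 * ((y - y') * (y - y'))));
      [ring|]; rewrite <- H; unfold_plane; ring. }
  assert (Hx := Rle_0_sqr (x - x')); assert (Hy := Rle_0_sqr (y - y')).
  unfold Rsqr in Hx, Hy.
  split; apply Rminus_diag_uniq, Rsqr_0_uniq; unfold Rsqr; lra.
Qed.

(** The weights of a point of the arc satisfy the equation of the circle written in
    the oblique basis of the radii to the end points. *)
Lemma arc60_weights (s : R) :
  let a := sin (PI / 3 - s) / sin (PI / 3) in
  let b := sin s / sin (PI / 3) in
  a ^ 2 + a * b + b ^ 2 = 1.
Proof.
  cbv zeta; rewrite sin_minus, cos_PI3, sin_PI3.
  assert (H3 : sqrt 3 * sqrt 3 = 3) by (apply sqrt_sqrt; lra).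
  assert (H0 : sqrt 3 <> 0) by (intro E; rewrite E in H3; lra).
  assert (Hcs := sin2_cos2 s); unfold Rsqr in Hcs.
  set (w := sqrt 3) in *; clearbody w.
  apply (Rmult_eq_reg_l (w * w)); [|nra].
  field_simplify; [|exact H0].
  apply (eq_modulo _ _ (cos s ^ 2 - 1) _ _ H3).
  apply (eq_modulo _ _ 3 _ _ Hcs); field.
Qed.

Lemma equilateral_rotation (r : R) (V1 V2 V3 : plane) :
  0 < r -> equilateral r V1 V2 V3 ->
  dot (minus V1 V3) (minus V1 V3) = r ^ 2 /\
  exists q, q * q = 3 /\
    V2 = plus V3 (((fst V1 - fst V3) / 2 + q * (snd V1 - snd V3) / 2,
                   (snd V1 - snd V3) / 2 - q * (fst V1 - fst V3) / 2) : plane).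
Proof.
  intros Hr (H12 & H23 & H31).
  apply (f_equal (fun x : R => x ^ 2)) in H12, H23, H31.
  rewrite pdist_sq in H12, H23, H31.
  assert (Hp : dot (minus V1 V3) (minus V1 V3) = r ^ 2)
    by (rewrite <- H31; unfold_plane; ring).
  split; [exact Hp|].
  assert (Hr2 : r ^ 2 <> 0) by (apply pow_nonzero; lra).
  set (x := fst V1 - fst V3); set (y := snd V1 - snd V3).
  set (x' := fst V2 - fst V3); set (y' := snd V2 - snd V3).
  assert (Gp : x * x + y * y = r ^ 2) by (rewrite <- Hp; unfold x, y; unfold_plane; ring).
  assert (Gu : x' * x' + y' * y' = r ^ 2)
    by (rewrite <- H23; unfold x', y'; unfold_plane; ring).
  assert (Gd : x * x' + y * y' = r ^ 2 / 2)
    by (unfold x, y, x', y'; unfold_plane; lra).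
  exists (- 2 * (x * y' - y * x') / r ^ 2); split.
  - transitivity (4 * ((x * x + y * y) * (x' * x' + y' * y')
       - (x * x' + y * y') ^ 2) / (r ^ 2) ^ 2); [field; lra|].
    rewrite Gp, Gu, Gd; field; lra.
  - apply plane_eq; unfold_plane.
    + transitivity (fst V3 + x'); [unfold x'; ring|]; f_equal.
      transitivity ((x * (x * x' + y * y') - y * (x * y' - y * x')) / r ^ 2).
      * transitivity ((x * x + y * y) * x' / r ^ 2); [rewrite Gp; field; lra | field; lra].
      * rewrite Gd; field; lra.
    + transitivity (snd V3 + y'); [unfold y'; ring|]; f_equal.
      transitivity ((y * (x * x' + y * y') + x * (x * y' - y * x')) / r ^ 2).
      * transitivity ((x * x + y * y) * y' / r ^ 2); [rewrite Gp; field; lra | field; lra].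
      * rewrite Gd; field; lra.
Qed.

(** The frame has origin M and first axis e = V3 - M.  If M = V3 + a (V1 - V3)
    + b (V2 - V3), then a^2 + a b + b^2 = 1, a conic through (-1, 0); t is the
    slope of the chord from (-1, 0) to (a, b), so that
    a = (1 - t^2) / (1 + t + t^2) and b = (2 t + t^2) / (1 + t + t^2).  The values
    t = 0 and t = 1 would be M = V1 and M = V2. *)
Lemma reuleaux_frame (r : R) (V1 V2 V3 M : plane) :
  0 < r -> equilateral r V1 V2 V3 ->
  on_arc60 V3 V1 V2 M -> M <> V1 -> M <> V2 ->
  exists (O e : plane) (q t : R),
    q * q = 3 /\ dot e e = r ^ 2 /\ 0 < t < 1 /\
    M = frame O e q 0 0 /\
    V1 = frame O e q (3 * t ^ 2 / (2 * (1 + t + t ^ 2)))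
                     (- (2 * t + t ^ 2) / (2 * (1 + t + t ^ 2))) /\
    V2 = frame O e q ((1 - t) ^ 2 / (2 * (1 + t + t ^ 2)))
                     ((1 - t ^ 2) / (2 * (1 + t + t ^ 2))) /\
    V3 = frame O e q 1 0.
Proof.
  intros Hr HV (s & Hs & HMs) HM1 HM2.
  destruct (equilateral_rotation _ _ _ _ Hr HV) as (Hp & q & Hq & HV2).
  assert (Hs0 : 0 < s).
  { destruct (proj1 Hs) as [|E]; [assumption|].
    exfalso; apply HM1; rewrite HMs, <- E; apply arc60_start. }
  assert (Hs1 : s < PI / 3).
  { destruct (proj2 Hs) as [|E]; [assumption|].
    exfalso; apply HM2; rewrite HMs, E; apply arc60_end. }
  assert (HPI := PI_RGT_0).
  assert (Hsin : 0 < sin (PI / 3)) by (apply sin_gt_0; lra).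
  assert (Hab := arc60_weights s); cbv zeta in Hab.
  unfold arc60 in HMs.
  assert (Ha : 0 < sin (PI / 3 - s) / sin (PI / 3))
    by (apply Rdiv_lt_0_compat; [apply sin_gt_0; lra | exact Hsin]).
  assert (Hb : 0 < sin s / sin (PI / 3))
    by (apply Rdiv_lt_0_compat; [apply sin_gt_0; lra | exact Hsin]).
  set (a := sin (PI / 3 - s) / sin (PI / 3)) in *.
  set (b := sin s / sin (PI / 3)) in *.
  clearbody a b; clear Hs Hs0 Hs1 HPI Hsin s.
  set (t := b / (1 + a)).
  assert (Ht0 : 0 < t) by (apply Rdiv_lt_0_compat; lra).
  assert (Ht1 : t < 1).
  { apply (Rmult_lt_reg_r (1 + a)); [lra|].
    replace (t * (1 + a)) with b by (unfold t; field; lra). nra. }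
  assert (Hn : (1 + t + t ^ 2) * (1 + a) ^ 2 = 2 + 2 * a + b).
  { replace ((1 + t + t ^ 2) * (1 + a) ^ 2)
      with ((1 + a) ^ 2 + b * (1 + a) + b ^ 2) by (unfold t; field; lra). lra. }
  assert (Hn0 : 1 + t + t ^ 2 <> 0) by nra.
  assert (Ea : a = (1 - t ^ 2) / (1 + t + t ^ 2)).
  { apply (Rmult_eq_reg_r ((1 + t + t ^ 2) * (1 + a) ^ 2)); [|rewrite Hn; lra].
    transitivity ((1 + a) ^ 2 * (1 - t ^ 2)); [|field; exact Hn0].
    rewrite Hn.
    transitivity ((1 + a) ^ 2 - b ^ 2); [nra | unfold t; field; lra]. }
  assert (Eb : b = (2 * t + t ^ 2) / (1 + t + t ^ 2)).
  { replace b with (t * (1 + a)) by (unfold t; field; lra).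
    rewrite Ea; field; exact Hn0. }
  exists M, (minus V3 M), q, t.
  replace (3 * t ^ 2 / (2 * (1 + t + t ^ 2))) with (1 - a - b / 2)
    by (rewrite Ea, Eb; field; exact Hn0).
  replace (- (2 * t + t ^ 2) / (2 * (1 + t + t ^ 2))) with (- b / 2)
    by (rewrite Eb; field; exact Hn0).
  replace ((1 - t) ^ 2 / (2 * (1 + t + t ^ 2))) with (1 - b - a / 2)
    by (rewrite Ea, Eb; field; exact Hn0).
  replace ((1 - t ^ 2) / (2 * (1 + t + t ^ 2))) with (a / 2)
    by (rewrite Ea; field; exact Hn0).
  clear Ea Eb Hn Hn0.
  set (x := fst V1 - fst V3) in *; set (y := snd V1 - snd V3) in *.
  assert (EV1 : V1 = plus V3 ((x, y) : plane))
    by (apply plane_eq; unfold x, y; unfold_plane; ring).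
  clearbody x y.
  assert (EM : M = plus V3 ((a * x + b * (x / 2 + q * y / 2),
                             a * y + b * (y / 2 - q * x / 2)) : plane)).
  { rewrite HMs, EV1, HV2; apply plane_eq; unfold_plane; ring. }
  clear HMs HM1 HM2 HV; rewrite EV1 in Hp; subst V1 V2 M.
  split; [exact Hq | split; [| split; [split; assumption |]]].
  { rewrite <- Hp; unfold_plane.
    apply (eq_modulo _ _ (x ^ 2 + y ^ 2) _ _ Hab).
    apply (eq_modulo _ _ (b ^ 2 * (x ^ 2 + y ^ 2) / 4) _ _ Hq); field. }
  unfold frame; repeat split; apply plane_eq; unfold_plane; try field.
  - apply (eq_modulo _ _ (- x) _ _ Hab).
    apply (eq_modulo _ _ (- x * b ^ 2 / 4) _ _ Hq); field.
  - apply (eq_modulo _ _ (- y) _ _ Hab).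
    apply (eq_modulo _ _ (- y * b ^ 2 / 4) _ _ Hq); field.
  - apply (eq_modulo _ _ (- (x / 2 + q * y / 2)) _ _ Hab).
    apply (eq_modulo _ _ (x * a * b / 4) _ _ Hq); field.
  - apply (eq_modulo _ _ (- (y / 2 - q * x / 2)) _ _ Hab).
    apply (eq_modulo _ _ (y * a * b / 4) _ _ Hq); field.
Qed.

(** * The five points and the excircle in the frame *)

Lemma frame_inversion (O e : plane) (r q k x y : R) :
  0 < r -> q * q = 3 -> dot e e = r ^ 2 -> x ^ 2 + 3 * y ^ 2 <> 0 ->
  inversion (frame O e q 0 0) k (frame O e q x y) =
  frame O e q (k ^ 2 / r ^ 2 * (x / (x ^ 2 + 3 * y ^ 2)))
              (k ^ 2 / r ^ 2 * (y / (x ^ 2 + 3 * y ^ 2))).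
Proof.
  intros Hr Hq He Hxy; unfold inversion.
  rewrite pdist_sq, (frame_dot O e r) by assumption.
  replace (r ^ 2 * ((x - 0) * (x - 0) + 3 * ((y - 0) * (y - 0))))
    with (r ^ 2 * (x ^ 2 + 3 * y ^ 2)) by ring.
  unfold frame; apply plane_eq; unfold_plane; field; split; try lra.
Qed.

(** The image is the solution of two linear equations; [u1], [u2] are, up to a
    factor, the coordinates of the velocity of the arc at its end point. *)
Lemma frame_pedal_start (O e X : plane) (r q a1 a2 b1 b2 c1 c2 x y : R) :
  0 < r -> q * q = 3 -> dot e e = r ^ 2 ->
  neg_pedal_image (arc60 (frame O e q c1 c2) (frame O e q a1 a2)
    (frame O e q b1 b2)) (frame O e q 0 0) 0 X ->
  let u1 := (b1 - c1) - (a1 - c1) / 2 in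
  let u2 := (b2 - c2) - (a2 - c2) / 2 in
  (x - a1) * a1 + 3 * ((y - a2) * a2) = 0 ->
  (x - 2 * a1) * u1 + 3 * ((y - 2 * a2) * u2) = 0 ->
  a1 * u2 - a2 * u1 <> 0 ->
  X = frame O e q x y.
Proof.
  intros Hr Hq He HX u1 u2 E1 E2 Hdet.
  destruct (frame_coords O e r q X Hr Hq He) as (x' & y' & ->).
  apply neg_pedal_arc60_start in HX; destruct HX as (_ & H1 & H2).
  repeat rewrite (frame_dot O e r) in H1 by assumption.
  repeat rewrite (frame_dot O e r) in H2 by assumption.
  assert (Hr2 : r ^ 2 <> 0) by (apply pow_nonzero; lra).
  destruct (linear_system_unique a1 (3 * a2) u1 (3 * u2) x' y' x y) as [-> ->];
    [| | | reflexivity].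
  - enough (r ^ 2 * ((x' - a1) * a1 + 3 * ((y' - a2) * a2)) = r ^ 2 * 0) as Z
      by (apply Rmult_eq_reg_l in Z; [lra | exact Hr2]).
    lra.
  - enough (r ^ 2 * ((x' - 2 * a1) * u1 + 3 * ((y' - 2 * a2) * u2)) = r ^ 2 * 0) as Z
      by (apply Rmult_eq_reg_l in Z; [lra | exact Hr2]).
    unfold u1, u2 in *; lra.
  - clearbody u1 u2; intro Z; apply Hdet; lra.
Qed.

Lemma frame_pedal_end (O e X : plane) (r q a1 a2 b1 b2 c1 c2 x y : R) :
  0 < r -> q * q = 3 -> dot e e = r ^ 2 ->
  neg_pedal_image (arc60 (frame O e q c1 c2) (frame O e q a1 a2)
    (frame O e q b1 b2)) (frame O e q 0 0) (PI / 3) X ->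
  let u1 := (b1 - c1) / 2 - (a1 - c1) in
  let u2 := (b2 - c2) / 2 - (a2 - c2) in
  (x - b1) * b1 + 3 * ((y - b2) * b2) = 0 ->
  (x - 2 * b1) * u1 + 3 * ((y - 2 * b2) * u2) = 0 ->
  b1 * u2 - b2 * u1 <> 0 ->
  X = frame O e q x y.
Proof.
  intros Hr Hq He HX u1 u2 E1 E2 Hdet.
  destruct (frame_coords O e r q X Hr Hq He) as (x' & y' & ->).
  apply neg_pedal_arc60_end in HX; destruct HX as (_ & H1 & H2).
  repeat rewrite (frame_dot O e r) in H1 by assumption.
  repeat rewrite (frame_dot O e r) in H2 by assumption.
  assert (Hr2 : r ^ 2 <> 0) by (apply pow_nonzero; lra).
  destruct (linear_system_unique b1 (3 * b2) u1 (3 * u2) x' y' x y) as [-> ->];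
    [| | | reflexivity].
  - enough (r ^ 2 * ((x' - b1) * b1 + 3 * ((y' - b2) * b2)) = r ^ 2 * 0) as Z
      by (apply Rmult_eq_reg_l in Z; [lra | exact Hr2]).
    lra.
  - enough (r ^ 2 * ((x' - 2 * b1) * u1 + 3 * ((y' - 2 * b2) * u2)) = r ^ 2 * 0) as Z
      by (apply Rmult_eq_reg_l in Z; [lra | exact Hr2]).
    unfold u1, u2 in *; lra.
  - clearbody u1 u2; intro Z; apply Hdet; lra.
Qed.

(** The angle V1 in the semicircle from M to its antipode is a right angle. *)
Lemma antipode_neg_pedal (r : R) (V1 V2 V3 M : plane) :
  0 < r -> equilateral r V1 V2 V3 -> pdist M V3 = r -> M <> V1 ->
  neg_pedal_curve (arc60 V3 V1 V2) 0 (PI / 3) M (plus V3 (minus V3 M)).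
Proof.
  intros Hr (H12 & H23 & H31) HM HM1.
  apply (f_equal (fun x : R => x ^ 2)) in H12, H23, H31, HM.
  rewrite pdist_sq in H12, H23, H31, HM.
  exists 0; split; [generalize PI_RGT_0; lra|].
  apply neg_pedal_arc60_start; split; [auto | split].
  - unfold_plane; lra.
  - unfold_plane; lra.
Qed.

(** Here [s] is rho / r and [K] is k^2 / r^2, which makes the equation free of r. *)
Lemma frame_focal_eq (O e : plane) (r q K s dx dy x y k rho : R) (c : plane) :
  0 < r -> q * q = 3 -> dot e e = r ^ 2 -> 0 < rho ->
  k ^ 2 = r ^ 2 * K -> rho ^ 2 = r ^ 2 * s ^ 2 ->
  c = frame O e q dx dy ->
  s ^ 2 * (x ^ 2 + 3 * y ^ 2) = (K - (dx * x + 3 * (dy * y))) ^ 2 ->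
  focal_eq (frame O e q 0 0) (minus c (frame O e q 0 0)) k rho (frame O e q x y).
Proof.
  intros Hr Hq He Hrho Hk Hs -> E.
  rewrite focal_eq_sq by exact Hrho.
  repeat rewrite (frame_dot O e r) by assumption.
  rewrite Hk, Hs.
  transitivity (r ^ 2 * r ^ 2 * (s ^ 2 * (x ^ 2 + 3 * y ^ 2))); [ring|].
  rewrite E; ring.
Qed.

Theorem corollary1
  (V1 V2 V3 M : plane) (r k : R)
  (P0 A1 A2 B1 B2 O' c : plane) (rho : R) (Cstar : plane -> Prop)
  (Hr : 0 < r)
  (HV : equilateral r V1 V2 V3)
  (HM : on_arc60 V3 V1 V2 M) (HM1 : M <> V1) (HM2 : M <> V2)
  (Hk : 0 < k)
  (HP0 : forall X : plane,
     neg_pedal_curve (arc60 V3 V1 V2) 0 (PI / 3) M X <-> X = P0)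
  (HA1 : neg_pedal_image (arc60 V2 V1 V3) M 0 A1)
  (HA2 : neg_pedal_image (arc60 V2 V1 V3) M (PI / 3) A2)
  (HB1 : neg_pedal_image (arc60 V1 V2 V3) M 0 B1)
  (HB2 : neg_pedal_image (arc60 V1 V2 V3) M (PI / 3) B2)
  (HC : is_conic Cstar)
  (HCP0 : Cstar P0) (HCA1 : Cstar A1) (HCA2 : Cstar A2)
  (HCB1 : Cstar B1) (HCB2 : Cstar B2)
  (HO1 : tangent_line (fun t => inversion M k (arc60 V2 V1 V3 t)) 0 O')
  (HO2 : tangent_line (fun t => inversion M k (arc60 V1 V2 V3 t)) 0 O')
  (Hc : excircle (inversion M k V1) O' (inversion M k V2) c rho) :
  (forall X : plane, Cstar X <-> polar_dual M k (circle_curve c rho) X) /\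
  (pdist M c < rho -> is_ellipse Cstar) /\
  (rho < pdist M c -> is_hyperbola Cstar) /\
  (pdist M c = rho -> is_parabola Cstar).
Proof.
  assert (Hrho : 0 < rho) by exact (proj1 Hc).
  apply (tangent_inversion_polar _ _ _ _ _ _ _ (is_derive_arc60 _ _ _ _) HA1) in HO1.
  apply (tangent_inversion_polar _ _ _ _ _ _ _ (is_derive_arc60 _ _ _ _) HB1) in HO2.
  assert (Hfocal : forall X, Cstar X <-> focal_eq M (minus c M) k rho X).
  { destruct (reuleaux_frame r V1 V2 V3 M Hr HV HM HM1 HM2)
      as (O & e & q & t & Hq & He & Ht & EM & EV1 & EV2 & EV3).
    assert (HMV3 : pdist M V3 = r).
    { rewrite pdist_sqrt, EM, EV3, (frame_dot O e r) by assumption.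
      rewrite <- (sqrt_pow2 r) at 2 by lra; f_equal; ring. }
    assert (EP0 := proj1 (HP0 _) (antipode_neg_pedal r V1 V2 V3 M Hr HV HMV3 HM1)).
    assert (EP0' : P0 = frame O e q 2 0).
    { rewrite <- EP0, EM, EV3; unfold frame; apply plane_eq; unfold_plane; ring. }
    clear HP0 EP0 HMV3 HM HM1 HM2 HV.
    subst M V1 V2 V3 P0.
    assert (Hn : 0 < 1 + t + t ^ 2) by nra.
    assert (Hn1 : 0 < 1 + 4 * t + t ^ 2) by nra.
    assert (Hn2 : 0 < 2 + 2 * t - t ^ 2) by nra.
    (* If P lies on a circle with centre C, its image is obtained by reflecting
       P - C in the line MP and rescaling.  For A1 and B1 this gives directions at
       60 degrees from e on either side, hence opposite or equal coordinates; A2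
       and B2 lie on the perpendicular to e at V3, where the first coordinate
       is 1. *)
    apply (frame_pedal_start _ _ _ r _ _ _ _ _ _ _
      (t / (1 + t)) (- (t / (1 + t))) Hr Hq He) in HA1; cbv zeta in HA1.
    2: { field; lra. }
    2: { field; lra. }
    2: { apply Rgt_not_eq.
         match goal with |- ?g > 0 => replace g with
           (3 * (t * (1 + t)) / (4 * (1 + t + t ^ 2))) by (field; lra) end.
         apply Rdiv_lt_0_compat; nra. }
    apply (frame_pedal_start _ _ _ r _ _ _ _ _ _ _
      ((1 - t) / (2 + t)) ((1 - t) / (2 + t)) Hr Hq He) in HB1.
    2: { field; lra. }
    2: { field; lra. }
    2: { apply Rlt_not_eq.
         match goal with |- ?g < 0 => replace g with
           (- ((1 - t) * (2 + t) / (4 * (1 + t + t ^ 2)))) by (field; lra) end.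
         apply Ropp_lt_gt_0_contravar, Rdiv_lt_0_compat; nra. }
    apply (frame_pedal_end _ _ _ r _ _ _ _ _ _ _
      1 ((1 - t ^ 2) / (1 + 4 * t + t ^ 2)) Hr Hq He) in HA2.
    2: { field; lra. }
    2: { field; lra. }
    2: { apply Rgt_not_eq.
         match goal with |- ?g > 0 => replace g with
           ((1 + 4 * t + t ^ 2) / (4 * (1 + t + t ^ 2))) by (field; lra) end.
         apply Rdiv_lt_0_compat; nra. }
    apply (frame_pedal_end _ _ _ r _ _ _ _ _ _ _
      1 (- (2 * t + t ^ 2) / (2 + 2 * t - t ^ 2)) Hr Hq He) in HB2.
    2: { field; lra. }
    2: { field; lra. }
    2: { apply Rlt_not_eq.
         match goal with |- ?g < 0 => replace g with
           (- ((2 + 2 * t - t ^ 2) / (4 * (1 + t + t ^ 2)))) by (field; lra) end.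
         apply Ropp_lt_gt_0_contravar, Rdiv_lt_0_compat; nra. }
    subst A1 A2 B1 B2.
    set (K := k ^ 2 / r ^ 2).
    assert (HK : k ^ 2 = r ^ 2 * K) by (unfold K; field; lra).
    assert (HK0 : 0 < K) by (apply Rdiv_lt_0_compat; nra).
    assert (Hr2 : r ^ 2 <> 0) by (apply pow_nonzero; lra).
    (* O' is the intersection of the polars of A1 and B1. *)
    destruct (frame_coords O e r q O' Hr Hq He) as (x & y & EO').
    unfold polar in HO1, HO2.
    rewrite EO', (frame_dot O e r), HK in HO1, HO2 by assumption.
    apply (Rmult_eq_reg_l _ _ _) in HO1; [|exact Hr2].
    apply (Rmult_eq_reg_l _ _ _) in HO2; [|exact Hr2].
    assert (HO1' : x - 3 * y = K * (1 + t) / t).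
    { rewrite <- HO1; field; lra. }
    assert (HO2' : x + 3 * y = K * (2 + t) / (1 - t)).
    { rewrite <- HO2; field; lra. }
    clear HO1 HO2.
    assert (Ex : x = K / 2 * ((1 + t) / t + (2 + t) / (1 - t))).
    { replace x with ((x - 3 * y + (x + 3 * y)) / 2) by field.
      rewrite HO1', HO2'; field; lra. }
    assert (Ey : y = K / 6 * ((2 + t) / (1 - t) - (1 + t) / t)).
    { replace y with ((x + 3 * y - (x - 3 * y)) / 6) by field.
      rewrite HO1', HO2'; field; lra. }
    clear HO1' HO2'.
    assert (EA : inversion (frame O e q 0 0) k
        (frame O e q (3 * t ^ 2 / (2 * (1 + t + t ^ 2)))
                     (- (2 * t + t ^ 2) / (2 * (1 + t + t ^ 2)))) =
        frame O e q (K / 2) (- K * (2 + t) / (6 * t))).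
    { assert (Hnorm : (3 * t ^ 2 / (2 * (1 + t + t ^ 2))) ^ 2
          + 3 * (- (2 * t + t ^ 2) / (2 * (1 + t + t ^ 2))) ^ 2 =
          3 * t ^ 2 / (1 + t + t ^ 2)) by (field; lra).
      assert (0 < 3 * t ^ 2 / (1 + t + t ^ 2)) by (apply Rdiv_lt_0_compat; nra).
      rewrite (frame_inversion O e r) by (assumption || (rewrite Hnorm; lra)).
      fold K; rewrite Hnorm; f_equal; field; lra. }
    assert (EB : inversion (frame O e q 0 0) k
        (frame O e q ((1 - t) ^ 2 / (2 * (1 + t + t ^ 2)))
                     ((1 - t ^ 2) / (2 * (1 + t + t ^ 2)))) =
        frame O e q (K / 2) (K * (1 + t) / (2 * (1 - t)))).
    { assert (Hnorm : ((1 - t) ^ 2 / (2 * (1 + t + t ^ 2))) ^ 2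
          + 3 * ((1 - t ^ 2) / (2 * (1 + t + t ^ 2))) ^ 2 =
          (1 - t) ^ 2 / (1 + t + t ^ 2)) by (field; lra).
      assert (0 < (1 - t) ^ 2 / (1 + t + t ^ 2)) by (apply Rdiv_lt_0_compat; nra).
      rewrite (frame_inversion O e r) by (assumption || (rewrite Hnorm; lra)).
      fold K; rewrite Hnorm; f_equal; field; lra. }
    rewrite EA, EB in Hc; clear EA EB.
    (* s is the height of the triangle V1'O'V2' divided by r; the side is
       2 / sqrt 3 times the height. *)
    set (s := 3 / 4 * K * ((1 + t) / (1 - t) + (2 + t) / (3 * t))).
    assert (Hs0 : 0 < s).
    { apply Rmult_lt_0_compat; [lra|].
      apply Rplus_lt_0_compat; apply Rdiv_lt_0_compat; lra. }
    assert (Hl : 0 < r ^ 2 * (4 / 3 * s ^ 2)).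
    { generalize (pow_lt r 2 Hr) (pow_lt s 2 Hs0); intros; nra. }
    destruct (fun l Hl Htri => equilateral_excircle l rho _ _ _ c Hl Htri Hc)
      with (l := sqrt (r ^ 2 * (4 / 3 * s ^ 2))) as [Ec Erho].
    { apply sqrt_lt_R0; exact Hl. }
    { split; [|split]; rewrite pdist_sqrt, ?EO', (frame_dot O e r) by assumption;
        f_equal; f_equal; subst x y; unfold s; field; lra. }
    rewrite pow2_sqrt in Erho by lra.
    assert (Es : rho ^ 2 = r ^ 2 * s ^ 2) by lra.
    assert (Ec' : c = frame O e q (K - x)
      (K * (1 + t) / (2 * (1 - t)) - K * (2 + t) / (6 * t) - y)).
    { rewrite Ec, EO'; unfold frame; apply plane_eq; unfold_plane; field; lra. }
    subst x y; clear Hc Ec Erho EO'.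
    apply conic_through_five_points with (Xs :=
      [frame O e q 2 0; frame O e q (t / (1 + t)) (- (t / (1 + t)));
       frame O e q ((1 - t) / (2 + t)) ((1 - t) / (2 + t));
       frame O e q 1 ((1 - t ^ 2) / (1 + 4 * t + t ^ 2));
       frame O e q 1 (- (2 * t + t ^ 2) / (2 + 2 * t - t ^ 2))]);
      try assumption; [| reflexivity |].
    - assert (F1 : 0 < t / (1 + t)) by (apply Rdiv_lt_0_compat; lra).
      assert (F2 : t / (1 + t) < 1).
      { apply (Rmult_lt_reg_r (1 + t)); [lra|]; field_simplify; lra. }
      assert (F3 : 0 < (1 - t) / (2 + t)) by (apply Rdiv_lt_0_compat; lra).
      assert (F4 : (1 - t) / (2 + t) < 1).
      { apply (Rmult_lt_reg_r (2 + t)); [lra|]; field_simplify; lra. }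
      assert (F5 : 0 < (1 - t ^ 2) / (1 + 4 * t + t ^ 2))
        by (apply Rdiv_lt_0_compat; nra).
      assert (F6 : 0 < (2 * t + t ^ 2) / (2 + 2 * t - t ^ 2))
        by (apply Rdiv_lt_0_compat; nra).
      rewrite Rdiv_opp_l.
      repeat apply NoDup_cons; try apply NoDup_nil; cbn [In]; intro Hin;
        repeat destruct Hin as [Hin | Hin];
        try exact Hin; apply (frame_inj O e r q) in Hin; try assumption;
        destruct Hin; lra.
    - intros X Hin; cbn [In] in Hin.
      split;
        [repeat destruct Hin as [<- | Hin]; try assumption; contradiction |].
      repeat destruct Hin as [<- | Hin]; try contradiction;
        apply (frame_focal_eq O e r q K s _ _ _ _ k rho c Hr Hq He Hrho HK Es Ec');
        unfold s; field; lra. }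
  assert (Hd : pdist M c ^ 2 = dot (minus c M) (minus c M))
    by (rewrite pdist_sq; unfold_plane; ring).
  assert (Hd0 := pdist_ge0 M c).
  split; [|split; [|split]].
  - intro X; rewrite polar_dual_circle by assumption; apply Hfocal.
  - intro H; apply (focal_ellipse M (minus c M) k rho); try assumption; nra.
  - intro H; apply (focal_hyperbola M (minus c M) k rho); try assumption; nra.
  - intro H; apply (focal_parabola M (minus c M) k rho); try assumption; nra.
Qed.
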